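(* Let $\Gamma=[0,T]$, let $X\subset\mathbb R^{n_x}$ and $\Theta\subset\mathbb R^{n_\theta}$ be compact and convex, and suppose $f,g\in C^1(\Gamma\times\mathbb R^{n_x}\times\Theta)$. Suppose $(x,\theta,\mathbf u)\in\mathrm{int}(X)\times\mathrm{int}(\Theta)\times C[0,T]$ is a stationary point of the optimization problem $$\min_{x\in X,\ \theta\in\Theta,\ \mathbf u\in C(\Gamma)}L_{ls}(x,\theta,\mathbf u)\quad\text{s.t.}\quad\mathbf u(t)=x+\int_0^tf(s,\mathbf u(s),\theta)\,ds\quad\text{for all }t\in\Gamma .$$ Then $$\nabla_{x,\theta}L_{ls}(x,\theta,\mathbf u)+\sum_{i=1}^{N_s}\nabla_{u_i}L_{ls}(x,\theta,\mathbf u)\,\nabla_{x,\theta}\phi(t_i,x,\theta)=0,$$ where $\phi$ is the solution map of the ODE $\dot{\mathbf u}(t)=f(t,\mathbf u(t),\theta)$, $\mathbf u(0)=x$, and $$\nabla_{u_i}L_{ls}(x,\theta,\mathbf u):=-\frac1{N_s}\big(y_i-g(t_i,\mathbf u(t_i),\theta)\big)^T\nabla_ug(t_i,\mathbf u(t_i),\theta).$$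
   Context: $f$ is $\mathbb R^{n_x}$-valued and $g$ is $\mathbb R^{n_y}$-valued. Data $(y_i,t_i)\in\mathbb R^{n_y}\times\Gamma$, $i=1,\dots,N_s$, are given, and $$L_{ls}(x,\theta,\mathbf u)=\frac1{2N_s}\sum_{i=1}^{N_s}\|y_i-g(t_i,\mathbf u(t_i),\theta)\|_2^2 .$$ It is assumed that the ODE has existence and uniqueness of solutions and continuous dependence on initial conditions and parameters, so that the solution map $\phi:\Gamma\times X\times\Theta\to\mathbb R^{n_x}$ with $\partial_t\phi(t,x,\theta)=f(t,\phi(t,x,\theta),\theta)$, $\phi(0,x,\theta)=x$ exists. $\nabla_{x,\theta}L_{ls}$ is the partial gradient (row vector) in $(x,\theta)$ with $\mathbf u$ held fixed; $\nabla_{x,\theta}\phi$ and $\nabla_ug$ are Jacobian matrices. A stationary point (in the Karush–Kuhn–Tucker sense) with $x,\theta$ interior is a feasible triple for which there is a continuous linear functional $\ell$ on $C[0,T]$ such that the Lagrangian $L_{ls}(x,\theta,\mathbf u)+\ell(\mathcal P_{x,\theta}\mathbf u-\mathbf u)$ has vanishing Fréchet derivative at $(x,\theta,\mathbf u)$, where $(\mathcal P_{x,\theta}\mathbf u)(t)=x+\int_0^tf(s,\mathbf u(s),\theta)\,ds$. *)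

(* Defs.v *)
From HB Require Import structures.
From mathcomp Require Import all_boot all_order all_algebra.
From mathcomp Require Import all_classical all_reals all_analysis.

Set Implicit Arguments.
Unset Strict Implicit.
Unset Printing Implicit Defensive.
Import Order.TTheory GRing.Theory Num.Theory.
Import numFieldNormedType.Exports.
Local Open Scope classical_set_scope.
Local Open Scope ring_scope.

(* Vectors are row vectors; ['J F p] acts on the right of
   row vectors, so the usual Jacobian matrix (one row per component of [F]) is
   its transpose. *)

Section contI.
Context {R : realType} (T : R) (V : normedModType R).

(* C([0, T]; V).  A continuous function on [0, T] is represented by its
   extension by 0 to R, so that two elements are equal as soon as they agree on
   [0, T] and the sup norm over [0, T] is a norm. *)
Definition contI_pred : {pred R -> V} :=
  mem [set u : R -> V | {within `[0, T], continuous u} /\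
                        forall t, t \notin `[0, T] -> u t = 0].

Record contI := ContI { contI_val :> R -> V ; _ : contI_val \in contI_pred }.

HB.instance Definition _ := [isSub for contI_val].
HB.instance Definition _ := [Choice of contI by <:].

Lemma contI_submod_closed : submod_closed contI_pred.
Proof.
split=> [|a u v /set_mem[cu u0] /set_mem[cv v0]]; apply/mem_set; split.
- by move=> t; exact: cvg_cst.
- by [].
- move=> t; apply: continuousD; last exact: cv.
  by apply: continuousZl_tmp; exact: cu.
- by move=> t tT; rewrite -[LHS]/(a *: u t + v t) u0// v0// scaler0 addr0.
Qed.

HB.instance Definition _ :=
  GRing.isSubmodClosed.Build _ _ contI_pred contI_submod_closed.
HB.instance Definition _ := [SubChoice_isSubLmodule of contI by <:].


Lemma contIP (u : contI) : {within `[0, T], continuous u} /\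
  forall t, t \notin `[0, T] -> u t = 0.
Proof. by case: u => w wP; exact: set_mem wP. Qed.

Lemma contI_eq (u v : contI) : {in `[0, T], u =1 v} -> u = v.
Proof.
move=> uv; apply/val_inj/funext => t /=.
have [/uv//|tT] := boolP (t \in `[0, T]).
by rewrite (contIP u).2// (contIP v).2.
Qed.

Definition contI_norm (u : contI) : R := sup [set `|u t| | t in `[0, T]].

Lemma contI_bounded (u : contI) : has_ubound [set `|u t| | t in `[0, T]].
Proof.
have /compact_bounded[M [Mr MP]] : compact (u @` `[0, T]).
  by apply: continuous_compact; [exact: (contIP u).1|exact: segment_compact].
exists (M + 1) => _ [t tT <-]; apply: (MP (M + 1)); first by rewrite ltrDl.
by exists t.
Qed.

Lemma contI_norm_ub (u : contI) t : t \in `[0, T] -> `|u t| <= contI_norm u.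
Proof. by move=> tT; apply: ub_le_sup; [exact: contI_bounded|exists t]. Qed.

Lemma contI_norm_le (u : contI) M : 0 <= M ->
  {in `[0, T], forall t, `|u t| <= M} -> contI_norm u <= M.
Proof.
move=> M0 uM; rewrite /contI_norm; have [->|/set0P S0] :=
  eqVneq [set `|u t| | t in `[0, T]%classic] set0; first by rewrite sup0.
by apply: ge_sup => // _ [t tT <-]; exact: uM.
Qed.

Lemma contI_norm_ge0 (u : contI) : 0 <= contI_norm u.
Proof.
have [T0|T0] := leP 0 T.
  by apply: le_trans (contI_norm_ub u (_ : 0 \in _)); rewrite // in_itv/= lexx.
by rewrite /contI_norm set_itv_ge ?bnd_simp -?ltNge// image_set0 sup0.
Qed.

Lemma contI_ler_normD (u v : contI) :
  contI_norm (u + v) <= contI_norm u + contI_norm v.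
Proof.
apply: contI_norm_le => [|t tT]; first by rewrite addr_ge0 ?contI_norm_ge0.
by rewrite (le_trans (ler_normD _ _))// lerD ?contI_norm_ub.
Qed.

Lemma contI_normrZ (a : R) (u : contI) :
  contI_norm (a *: u) = `|a| * contI_norm u.
Proof.
have le b w : contI_norm (b *: w) <= `|b| * contI_norm w.
  apply: contI_norm_le => [|t tT]; first by rewrite mulr_ge0 ?contI_norm_ge0.
  by rewrite -[_ t]/(b *: w t) normrZ ler_wpM2l// contI_norm_ub.
apply/eqP; rewrite eq_le le/=; have [->|a0] := eqVneq a 0.
  by rewrite normr0 mul0r contI_norm_ge0.
rewrite mulrC -ler_pdivlMr ?normr_gt0// mulrC -normfV.
by rewrite -[in leLHS](scalerK a0 u) le.
Qed.

Lemma contI_normr0_eq0 (u : contI) : contI_norm u = 0 -> u = 0.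
Proof.
move=> u0; apply: contI_eq => t tT; apply/eqP.
by rewrite -normr_le0 -u0 contI_norm_ub.
Qed.

HB.instance Definition _ := Lmodule_isNormed.Build R contI
  contI_ler_normD contI_normrZ contI_normr0_eq0.

(* The element of C([0, T]; V) given by the values of [w] on [0, T]; it is 0 if
   [w] is not continuous on [0, T]. *)
Definition to_contI (w : R -> V) : contI :=
  insubd 0 (fun t => if t \in `[0, T] then w t else 0).

Lemma to_contIE (w : R -> V) : {within `[0, T], continuous w} ->
  {in `[0, T], to_contI w =1 w}.
Proof.
move=> cw t tT; rewrite /to_contI insubdK ?tT//.
apply/mem_set; split=> [|s /negbTE-> //].
apply: (subspace_eq_continuous _ cw) => s /set_mem sT.
by rewrite /from_subspace ifT.
Qed.

End contI.

Section problem.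
Context {R : realType} {nx nt ny N : nat}.
Implicit Types (T : R) (x : 'rV[R]_nx) (th : 'rV[R]_nt).

(* [F] is C^1 on the (not open) set [0, T] x R^nx x Th: it has at each point of
   this set a differential relative to the set, and these differentials can be
   chosen continuous (evaluating at each [h] suffices in finite dimension). On
   a convex set with nonempty interior this amounts to being C^1 in the interior
   with derivatives that extend continuously. *)
Definition C1_on T (Th : set 'rV[R]_nt) {m : nat}
    (F : R -> 'rV[R]_nx -> 'rV[R]_nt -> 'rV[R]_m) :=
  let A : set (R^o * 'rV[R]_nx * 'rV[R]_nt) := `[0, T] `*` setT `*` Th in
  let Fu z := F z.1.1 z.1.2 z.2 in
  exists dF : R^o * 'rV[R]_nx * 'rV[R]_nt ->
      {linear (R^o * 'rV[R]_nx * 'rV[R]_nt)%type -> 'rV[R]_m},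
    (forall z, A z -> let W := within A (nbhs z) in
      (fun z' => Fu z' - Fu z - dF z (z' - z)) =o_W (fun z' => z' - z)) /\
    (forall h, {within A, continuous (fun z => dF z h)}).

(* At the endpoints of [0, T] the derivative is one-sided. *)
Definition ode_solution T (f : R -> 'rV[R]_nx -> 'rV[R]_nt -> 'rV[R]_nx)
    x th (u : R -> 'rV[R]_nx) :=
  u 0 = x /\
  forall t, t \in `[0, T] ->
    (s - t)^-1 *: (u s - u t) @[s --> within `[0, T] t^'] --> f t (u t) th.

Definition solution_map T (X : set 'rV[R]_nx) (Th : set 'rV[R]_nt)
    (f : R -> 'rV[R]_nx -> 'rV[R]_nt -> 'rV[R]_nx)
    (phi : R -> 'rV[R]_nx -> 'rV[R]_nt -> 'rV[R]_nx) :=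
  [/\ forall x th, X x -> Th th -> ode_solution T f x th (phi ^~ x ^~ th),
      forall x th u, X x -> Th th -> ode_solution T f x th u ->
        {in `[0, T], u =1 phi ^~ x ^~ th} &
      {within `[0, T] `*` X `*` Th,
        continuous (fun z : R * 'rV[R]_nx * 'rV[R]_nt => phi z.1.1 z.1.2 z.2)}].

Definition picard_fun (f : R -> 'rV[R]_nx -> 'rV[R]_nt -> 'rV[R]_nx)
    x th (u : R -> 'rV[R]_nx) (t : R) : 'rV[R]_nx :=
  x + \row_j \int[lebesgue_measure]_(s in `[0, t]) (f s (u s) th 0 j).

Definition picard T (f : R -> 'rV[R]_nx -> 'rV[R]_nt -> 'rV[R]_nx)
    x th (u : contI T 'rV[R]_nx) : contI T 'rV[R]_nx :=
  to_contI T (picard_fun f x th u).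

Lemma row_cvg n (I : Type) (F : set_system I) (FF : Filter F)
    (w : I -> 'rV[R]_n) (v : 'rV[R]_n) :
  (forall j, w i 0 j @[i --> F] --> v 0 j) -> w @ F --> v.
Proof.
move=> h; apply/cvgrPdist_le => e e0.
have H : \forall i \near F, forall j, `|v 0 j - w i 0 j| <= e.
  by apply: filter_forall => j; have /cvgrPdist_le/(_ e e0) := h j.
apply: filterS H => i wi.
rewrite [leLHS]/Num.norm/= mx_normrE; apply/bigmax_leP; split; first exact: ltW.
by move=> [a j] _ /=; rewrite !mxE ord1.
Qed.

(* For continuous [f] the value 0 of [to_contI] is never used in [picard]. *)
Lemma picardE T (Th : set 'rV[R]_nt)
    (f : R -> 'rV[R]_nx -> 'rV[R]_nt -> 'rV[R]_nx)
    x th (u : contI T 'rV[R]_nx) :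
  {within `[0, T] `*` setT `*` Th,
    continuous (fun z : R * 'rV[R]_nx * 'rV[R]_nt => f z.1.1 z.1.2 z.2)} ->
  Th th -> {in `[0, T], picard f x th u =1 picard_fun f x th u}.
Proof.
move=> cf thTh t tT; apply: to_contIE (tT) => {t tT}.
have [T0|T0] := leP 0 T; last first.
  apply/subspace_continuousP => t.
  by rewrite /= in_itv/= => /andP[/le_trans/[apply]]; rewrite leNgt T0.
have cfu : {within `[0, T], continuous (fun s => f s (u s) th)}.
  apply/subspace_continuousP => s sT.
  move/subspace_continuousP : cf => /(_ (s, u s, th)) /= cf.
  apply: cvg_trans (cf _); last by [].
  move=> B /= [[W V] [[[W1 W2] [W1s W2s] sW]] Vs sB].
  have /subspace_continuousP/(_ s sT) cu := (contIP u).1.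
  move: (cu _ W2s); rewrite /= /within/=; rewrite /nbhs/=; near_simpl => H.
  near=> r => rT; apply: (sB (r, u r, th)) => //.
  split; last exact: nbhs_singleton Vs.
  apply: sW; split; first by near: r.
  by move: rT; near: r.
apply/subspace_continuousP => t tT; apply: cvgD; first exact: cvg_cst.
apply: row_cvg => j; rewrite mxE.
under eq_fun do rewrite mxE.
have : {within `[0, T], continuous (fun s => f s (u s) th 0 j)}.
  move=> s; apply: (@continuous_comp (subspace _) _ _
    (fun s => f s (u s) th) (fun v : 'rV[R]_nx => v 0 j)); first exact: cfu.
  exact: coord_continuous.
move=> /(continuous_compact_integrable (@segment_compact _ 0 T)).
by move=> /(parameterized_integral_continuous T0) /subspace_continuousP; apply.
Unshelve. all: end_near. Qed.

(* The squared Euclidean norm; the library norm of ['rV_n] is the max norm. *)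
Definition sqnorm2 {n : nat} (v : 'rV[R]_n) : R := \sum_j v 0 j ^+ 2.

Definition Lls (g : R -> 'rV[R]_nx -> 'rV[R]_nt -> 'rV[R]_ny)
    (y : 'I_N -> 'rV[R]_ny) (t : 'I_N -> R) x th (u : R -> 'rV[R]_nx) : R :=
  (2 * N%:R)^-1 * \sum_i sqnorm2 (y i - g (t i) (u (t i)) th).

Definition lagrangian T (f : R -> 'rV[R]_nx -> 'rV[R]_nt -> 'rV[R]_nx)
    (g : R -> 'rV[R]_nx -> 'rV[R]_nt -> 'rV[R]_ny)
    (y : 'I_N -> 'rV[R]_ny) (t : 'I_N -> R) (l : contI T 'rV[R]_nx -> R)
    (z : 'rV[R]_nx * 'rV[R]_nt * contI T 'rV[R]_nx) : R :=
  Lls g y t z.1.1 z.1.2 z.2 + l (picard f z.1.1 z.1.2 z.2 - z.2).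

Definition stationary_point T (X : set 'rV[R]_nx) (Th : set 'rV[R]_nt)
    (f : R -> 'rV[R]_nx -> 'rV[R]_nt -> 'rV[R]_nx)
    (g : R -> 'rV[R]_nx -> 'rV[R]_nt -> 'rV[R]_ny)
    (y : 'I_N -> 'rV[R]_ny) (t : 'I_N -> R) x th (u : contI T 'rV[R]_nx) :=
  [/\ X x, Th th,
      {in `[0, T], u =1 picard_fun f x th u} &
      exists l : {linear contI T 'rV[R]_nx -> R^o},
        [/\ continuous l,
            differentiable (lagrangian f g y t l) (x, th, u) &
            'd (lagrangian f g y t l) (x, th, u) = 0 :> (_ -> _)]].

Definition grad {n : nat} (F : 'rV[R]_n -> R) (p : 'rV[R]_n) : 'rV[R]_n :=
  \row_j 'D_(delta_mx 0 j) F p.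

Definition grad_xth_Lls (g : R -> 'rV[R]_nx -> 'rV[R]_nt -> 'rV[R]_ny)
    (y : 'I_N -> 'rV[R]_ny) (t : 'I_N -> R) x th (u : R -> 'rV[R]_nx) :
    'rV[R]_(nx + nt) :=
  grad (fun p => Lls g y t (lsubmx p) (rsubmx p) u) (row_mx x th).

Definition state_param_map (phi : R -> 'rV[R]_nx -> 'rV[R]_nt -> 'rV[R]_nx)
    (t : R) (p : 'rV[R]_(nx + nt)) : 'rV[R]_nx :=
  phi t (lsubmx p) (rsubmx p).

Definition jac_xth (phi : R -> 'rV[R]_nx -> 'rV[R]_nt -> 'rV[R]_nx)
    (t : R) x th : 'M[R]_(nx, nx + nt) :=
  ('J (state_param_map phi t) (row_mx x th))^T.

Definition jac_u (g : R -> 'rV[R]_nx -> 'rV[R]_nt -> 'rV[R]_ny)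
    (t : R) (v : 'rV[R]_nx) th : 'M[R]_(ny, nx) :=
  ('J (fun w => g t w th) v)^T.

(* The vector y_i - g(...) is already a row, so it carries no transpose. *)
Definition grad_ui_Lls (g : R -> 'rV[R]_nx -> 'rV[R]_nt -> 'rV[R]_ny)
    (y : 'I_N -> 'rV[R]_ny) (t : 'I_N -> R) th (u : R -> 'rV[R]_nx)
    (i : 'I_N) : 'rV[R]_nx :=
  - (N%:R^-1 *: ((y i - g (t i) (u (t i)) th) *m jac_u g (t i) (u (t i)) th)).

End problem.

(* Main.v *)
Require Import Defs.
From HB Require Import structures.
From mathcomp Require Import all_boot all_order all_algebra.
From mathcomp Require Import all_classical all_reals all_analysis.
From mathcomp Require Import ring lra.
Set Implicit Arguments.
Unset Strict Implicit.
Unset Printing Implicit Defensive.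
Import Order.TTheory GRing.Theory Num.Theory.
Import numFieldNormedType.Exports.
Local Open Scope classical_set_scope.
Local Open Scope ring_scope.

(** Along the feasible set the Lagrangian is the reduced objective, so a
   stationary point is a critical point of the objective as a function of the
   initial value and the parameter alone; the chain rule then gives the formula.

   Every pair (x', th') near (x, th) yields the feasible triple
   z(x', th') = (x', th', phi(., x', th')), on which the constraint term
   l (picard u - u) vanishes ([flow_feasible]). Moreover
   u = phi(., x, th) by uniqueness of solutions ([stationary_flow]). If z is
   Lipschitz at (x, th) for the sup norm, then the zero differential of
   the Lagrangian at z(x, th) turns into a zero differential of
   (x', th') |-> L_ls (z (x', th')) at (x, th)
   ([reduced_objective_stationary]), to which l contributes only through
   l 0 = 0. If in addition phi(t_i, .) is differentiable at (x, th), the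
   differential of this composite is the left-hand side of the claim
   ([is_diff_Lls]).

   Both properties of phi are facts about smooth dependence on initial data.
   Write p for the pair (x, th) and w_h(s) = phi(s, p + h) - phi(s, p). As f is
   C^1, w_h solves the linear variational equation up to an error
   o(max(|w_h|, |h|)), uniformly in s because [0, T] is compact
   ([uniform_linearization], [flow_variation]). Gronwall's inequality gives
   |w_h| <= L |h| ([variation_lipschitz]). Applied to w_h minus the combination
   of the difference quotients w_{a e_i} / a with the coefficients h_i, which
   starts at 0 and solves the same equation up to o(|h|), it shows that w_h is
   o(|h|)-close to this combination ([variation_quotient]). So the matrices of
   difference quotients are Cauchy as a tends to 0, and their limit is the
   derivative of phi(s, .) ([differentiable_of_linear_approx]). The matrix
   solution of the variational equation thus arises as a limit. *)

(** * Matrix norms and differentials *)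

Section matrix_norm.
Context {R : realType}.

Lemma mx_norm_entry m n (A : 'M[R]_(m, n)) i j : `|A i j| <= `|A|.
Proof.
rewrite [leRHS]/Num.norm/= mx_normrE.
exact: (le_bigmax _ (fun ij : 'I_m * 'I_n => `|A ij.1 ij.2|) (i, j)).
Qed.

Lemma mx_norm_le m n (A : 'M[R]_(m, n)) c : 0 <= c ->
  (forall i j, `|A i j| <= c) -> `|A| <= c.
Proof.
move=> c0 Ac; rewrite [leLHS]/Num.norm/= mx_normrE.
by apply/bigmax_leP; split=> // -[i j] _; exact: Ac.
Qed.

Lemma mx_norm_mulmx m n p (A : 'M[R]_(m, n)) (B : 'M[R]_(n, p)) :
  `|A *m B| <= n%:R * `|B| * `|A|.
Proof.
apply: mx_norm_le => [|i j]; first by rewrite !mulr_ge0.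
rewrite mxE (le_trans (ler_norm_sum _ _ _))//.
rewrite -mulrA mulr_natl -[X in _ *+ X]card_ord -sumr_const; apply: ler_sum => k _.
by rewrite normrM mulrC ler_pM// mx_norm_entry.
Qed.

Lemma mx_norm_row_mx m n1 n2 (A : 'M[R]_(m, n1)) (B : 'M[R]_(m, n2)) :
  `|row_mx A B| <= Num.max `|A| `|B|.
Proof.
apply: mx_norm_le => [|i j]; first by rewrite le_max normr_ge0.
by rewrite mxE le_max; case: (fintype.split j) => k; rewrite mx_norm_entry ?orbT.
Qed.

Lemma mx_norm_lsubmx m n1 n2 (A : 'M[R]_(m, n1 + n2)) : `|lsubmx A| <= `|A|.
Proof. by apply: mx_norm_le => // i j; rewrite mxE mx_norm_entry. Qed.

Lemma mx_norm_rsubmx m n1 n2 (A : 'M[R]_(m, n1 + n2)) : `|rsubmx A| <= `|A|.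
Proof. by apply: mx_norm_le => // i j; rewrite mxE mx_norm_entry. Qed.

Lemma mx_norm_delta m n (i : 'I_m) (j : 'I_n) : `|delta_mx i j : 'M[R]_(m, n)| = 1.
Proof.
apply/eqP; rewrite eq_le; apply/andP; split.
  by apply: mx_norm_le => // k l; rewrite mxE; case: (_ && _); rewrite ?normr1 ?normr0.
by rewrite (le_trans _ (mx_norm_entry _ i j))// mxE !eqxx normr1.
Qed.

End matrix_norm.

Section differential.
Context {R : realType} {V W : normedModType R}.

Lemma linear_bounded_cont (L : {linear V -> W}) (c : R) :
  (forall h, `|L h| <= c * `|h|) -> continuous L.
Proof.
move=> Lc; apply/(linear_bounded_continuous L).1/linear_boundedP; near=> r => h.
by rewrite (le_trans (Lc h))// ler_wpM2r.
Unshelve. all: end_near. Qed.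

(** The unfolded little-o estimate: later remainders are bounded by norm
   inequalities, which compose better than Landau terms. *)
Lemma is_diff_eps (F : V -> W) (x : V) (L : {linear V -> W}) :
  continuous L ->
  (forall e, 0 < e -> \forall h \near 0, `|F (x + h) - F x - L h| <= e * `|h|) ->
  is_diff x F L.
Proof.
move=> cL FL.
have FE : F \o shift x = cst (F x) + L +o_ 0 id.
  apply/eqaddoP => e e0; have := FL _ e0; apply: filterS => h /=.
  by rewrite /= !fctE opprD addrA (addrC x h).
have dE := diff_unique cL FE.
apply: DiffDef; last exact: dE.
by apply/diff_locallyP; rewrite dE; split.
Qed.

Lemma diff_eps (F : V -> W) (x : V) : differentiable F x ->
  forall e, 0 < e ->
  \forall h \near 0, `|F (x + h) - F x - 'd F x h| <= e * `|h|.
Proof.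
move=> /diff_locallyP[_ /eqaddoP FE] e e0; have := FE _ e0.
by apply: filterS => h; rewrite /= !fctE opprD addrA (addrC x h).
Qed.

Lemma is_diff_shift (F : V -> W) (L : {linear V -> W}) (a k : V) :
  is_diff (a + k) F L -> is_diff k (fun k => F (a + k)) L.
Proof.
move=> [dF dL]; apply: is_diff_eps; first by rewrite -dL; exact: diff_continuous.
move=> e e0; have := diff_eps dF e0.
by apply: filterS => h; rewrite dL addrA.
Qed.

End differential.

(** * Mean value inequality and Gronwall's lemma *)

Section mean_value.
Context {R : realType}.

Lemma is_derive_entry m n (w : R -> 'M[R]_(m, n)) (t : R) dw i j :
  is_derive t 1 w dw -> is_derive t 1 (fun s => w s i j) (dw i j).
Proof.
move=> [dwt <-]; have := dwt; rewrite derivable_mxP => dwij.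
by rewrite (derive_mx dwt) mxE; exact: derivableP.
Qed.

Lemma is_derive_row n (w : R -> 'rV[R]_n) (dw : 'rV[R]_n) (t : R) :
  (forall j, is_derive t 1 (fun s => w s 0 j) (dw 0 j)) -> is_derive t 1 w dw.
Proof.
move=> wj; have dwt : derivable w t 1.
  by apply/derivable_mxP => i j; rewrite ord1; have [] := wj j.
apply: DeriveDef => //; rewrite derive_mx//; apply/rowP => j.
by rewrite mxE; have [] := wj j.
Qed.

Lemma within_cont_entry (A : set R) m n (w : R -> 'M[R]_(m, n)) i j :
  {within A, continuous w} -> {within A, continuous (fun s => w s i j)}.
Proof.
move=> cw s; apply: (@continuous_comp (subspace _) _ _ w (fun v : 'M[R]_(m, n) => v i j)).
  exact: cw.
exact: coord_continuous.
Qed.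

(** The max norm is not differentiable, so the bound is applied to one coordinate
   at a time: G - w_j and G + w_j have a nonnegative derivative. *)
Lemma mean_value_le n (a b : R) (w dw : R -> 'rV[R]_n) (G dG : R -> R) : a <= b ->
  {within `[a, b], continuous w} -> {within `[a, b], continuous G} ->
  (forall t, t \in `]a, b[ -> is_derive t 1 w (dw t)) ->
  (forall t, t \in `]a, b[ -> is_derive t 1 G (dG t)) ->
  (forall t, t \in `]a, b[ -> `|dw t| <= dG t) ->
  `|w b - w a| <= G b - G a.
Proof.
move=> ab cw cG dwP dGP dwG.
have scalar (v dv : R -> R) : {within `[a, b], continuous v} ->
    (forall t, t \in `]a, b[ -> is_derive t 1 v (dv t)) ->
    (forall t, t \in `]a, b[ -> dv t <= dG t) -> v b - v a <= G b - G a.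
  move=> cv dvP dvG.
  move: ab; rewrite le_eqVlt => /predU1P[<-|ab]; first by rewrite !subrr.
  have [||c cab] := @MVT _ (G - v) (dG - dv) _ _ ab.
  - by move=> t tab; apply: is_deriveB; [exact: dGP|exact: dvP].
  - by move=> t; apply: (@continuousB _ _ (subspace `[a, b]) G v); [exact: cG|exact: cv].
  rewrite -[(G - v) b]/(G b - v b) -[(G - v) a]/(G a - v a) => E.
  have : 0 <= (dG - dv) c * (b - a).
    by rewrite mulr_ge0 ?subr_ge0 ?(ltW ab)//; exact: dvG.
  rewrite -E; lra.
have le0 : 0 <= G b - G a.
  have := scalar (cst 0) (cst 0); rewrite subrr; apply => //.
  - by move=> t; exact: cvg_cst.
  - by move=> t tab; rewrite (le_trans _ (dwG _ tab)).
apply: mx_norm_le => // i j; rewrite !mxE ord1 ler_norml lerNl; apply/andP; split.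
  rewrite opprD.
  apply: (scalar (fun s => - w s 0 j) (fun s => - dw s 0 j)).
  - by move=> t; apply: continuousN; exact: within_cont_entry.
  - by move=> t tab; apply: is_deriveN; apply: is_derive_entry; exact: dwP.
  - move=> t tab; rewrite (le_trans _ (dwG _ tab))// (le_trans _ (mx_norm_entry _ 0 j))//.
    by rewrite -normrN ler_norm.
apply: (scalar (fun s => w s 0 j) (fun s => dw s 0 j)).
- exact: within_cont_entry.
- by move=> t tab; apply: is_derive_entry; exact: dwP.
- move=> t tab; rewrite (le_trans _ (dwG _ tab))//.
  by rewrite (le_trans _ (mx_norm_entry _ 0 j))// ler_norm.
Qed.

(** With m the maximum of exp (- 2 K t) |w t|, the speed of w is at most
   K m exp (2 K t) + b, which is the derivative of (m / 2) exp (2 K t) + b t. The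
   mean value inequality at the point where m is attained gives
   m <= m / 2 + |w 0| + b T, hence m <= 2 (|w 0| + b T); the weight 2 K rather
   than K is what leaves the factor 1/2. *)
Lemma gronwall n (T K b : R) (w dw : R -> 'rV[R]_n) : 0 <= T -> 0 < K -> 0 <= b ->
  {within `[0, T], continuous w} ->
  (forall t, t \in `]0, T[ -> is_derive t 1 w (dw t)) ->
  (forall t, t \in `]0, T[ -> `|dw t| <= K * `|w t| + b) ->
  forall t, t \in `[0, T] -> `|w t| <= 2 * expR (2 * K * T) * (`|w 0| + b * T).
Proof.
move=> T0 K0 b0 cw dwP dwK.
pose m t := expR (- (2 * K) * t) * `|w t|.
have mdef t : m t = expR (- (2 * K) * t) * `|w t| by [].
have cm : {within `[0, T], continuous m}.
  move=> t; apply: (@cvgM R (subspace `[0, T])).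
    apply: continuous_subspaceT => s.
    apply: (@continuous_comp _ _ _ ( *%R (- (2 * K))) expR).
      exact: mulrl_continuous.
    exact: continuous_expR.
  apply: (@continuous_comp (subspace _) _ _ w Num.norm); first exact: cw.
  exact: norm_continuous.
have [c c0T cmax] := EVT_max T0 cm.
have mE t : `|w t| = expR (2 * K * t) * m t.
  by rewrite /m mulrA -expRD mulNr subrr expR0 mul1r.
have wle t : t \in `[0, T] -> `|w t| <= expR (2 * K * t) * m c.
  by move=> t0T; rewrite mE ler_pM2l ?expR_gt0// cmax.
have mc0 : 0 <= m c by rewrite mdef mulr_ge0// expR_ge0.
clearbody m; move: (c0T); rewrite in_itv/= => /andP[c0 cT].
have dE (s : R) : is_derive s 1 (fun s => expR (2 * K * s) * (m c / 2) + b * s)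
   (K * (expR (2 * K * s) * m c) + b).
  apply: is_derive_eq.
  by rewrite scaler0 add0r -![_ *: _]/(_ * _); field.
have sub0c : `[0, c] `<=` `[0, T] by apply: subset_itvl; rewrite bnd_simp.
have sub0co t : t \in `]0, c[ -> t \in `]0, T[.
  by rewrite !in_itv/= => /andP[-> /lt_le_trans ->].
have wc := @mean_value_le _ 0 c w dw _ _ c0 (continuous_subspaceW sub0c cw) _
  (fun t tc => dwP t (sub0co t tc)) (fun t _ => dE t) _.
have {}wc : `|w c - w 0| <= expR (2 * K * c) * (m c / 2) + b * c - (m c / 2).
  have E0 : m c / 2 = expR (2 * K * 0) * (m c / 2) + b * 0.
    by rewrite !mulr0 expR0 mul1r addr0.
  rewrite [X in _ <= _ - X]E0.
  apply: wc => [|t /sub0co tT].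
    by apply: derivable_within_continuous => s _; have [] := dE s.
  rewrite (le_trans (dwK _ tT))// lerD2r ler_pM2l// wle//.
  exact: subset_itv_oo_cc.
have mc : m c <= 2 * (`|w 0| + b * T).
  have e1 : expR (- (2 * K * c)) <= 1.
    by rewrite -expR0 ler_expR oppr_le0 !mulr_ge0// ltW.
  have wcb : `|w c| <= expR (2 * K * c) * (m c / 2) + (`|w 0| + b * T).
    have := ler_normD (w c - w 0) (w 0); rewrite subrK => /le_trans; apply.
    have : b * c <= b * T by rewrite ler_wpM2l.
    lra.
  have : m c <= m c / 2 + (`|w 0| + b * T).
    rewrite {1}mdef (le_trans (ler_wpM2l (expR_ge0 _) wcb))// mulrDr !mulrA -expRD.
    by rewrite mulNr addNr expR0 mul1r lerD2l ler_piMl ?addr_ge0 ?mulr_ge0.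
  lra.
move=> t tT; rewrite (le_trans (wle _ tT))//.
have -> : 2 * expR (2 * K * T) * (`|w 0| + b * T) =
    expR (2 * K * T) * (2 * (`|w 0| + b * T)) by ring.
apply: ler_pM; rewrite ?expR_ge0 ?mc ?mc0 ?ler_expR//.
by rewrite ler_pM2l ?mulr_gt0//; move: tT; rewrite in_itv/= => /andP[].
Qed.

End mean_value.

(** * Differentiability by approximation, uniformly on compact sets *)

Section smooth_dependence.
Context {R : realType}.

Lemma is_derive1_diff (W : normedModType R) (F L : R -> W) (x : R) :
  is_diff x F L -> is_derive x 1 F (L 1).
Proof.
by move=> [dF <-]; apply: DeriveDef; [exact: diff_derivable|rewrite deriveE].
Qed.

Lemma mulmxr_cont p m n (Q : 'M[R]_(m, n)) :
  continuous (mulmxr Q : 'M[R]_(p, m) -> 'M[R]_(p, n)).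
Proof. by apply: linear_bounded_cont => h; exact: mx_norm_mulmx. Qed.

(** The linear maps Q s depend on s, but two of them differ by at most 2 e as soon
   as both approximate the increments of F up to e: they are Cauchy as s tends to
   0, and the limit is the differential. *)
Lemma differentiable_of_linear_approx m n (F : 'rV[R]_m -> 'rV[R]_n)
    (p : 'rV[R]_m) (Q : R -> 'M[R]_(m, n)) :
  (forall e, 0 < e -> exists2 d, 0 < d & forall h s, `|h| <= d -> 0 < s <= d ->
    `|F (p + h) - F p - h *m Q s| <= e * `|h|) ->
  differentiable F p.
Proof.
move=> FQ.
have cvgQ : cvg (Q s @[s --> 0^'+]).
  apply/cauchy_cvgP/cauchy_exP => e e0.
  have [|d d0 Fd] := FQ (e / 3); first by rewrite divr_gt0.
  exists (Q d).
  suff : \forall s \near 0^'+, ball (Q d) e (Q s) by [].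
  near=> s; rewrite -ball_normE /=; apply: (@le_lt_trans _ _ (2 * (e / 3))); last by lra.
  apply: mx_norm_le => [|i j]; first by lra.
  (* Testing on h = d e_i, of norm exactly d, compares row i of Q d and Q s. *)
  have dd : `|d *: delta_mx 0 i : 'rV[R]_m| = d.
    by rewrite normrZ mx_norm_delta mulr1 gtr0_norm.
  have := Fd (d *: delta_mx 0 i) d; rewrite dd lexx d0 => /(_ isT isT) Fdd.
  have sd : 0 < s <= d.
    by apply/andP; split; near: s; [exact: nbhs_right_gt|exact: nbhs_right_le].
  have := Fd (d *: delta_mx 0 i) s; rewrite dd lexx sd => /(_ isT isT) Fds.
  have := ler_normB (F (p + d *: delta_mx 0 i) - F p - d *: delta_mx 0 i *m Q s)
                    (F (p + d *: delta_mx 0 i) - F p - d *: delta_mx 0 i *m Q d).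
  rewrite opprB addrC addrA subrK => H.
  have {}H : `|(d *: delta_mx 0 i : 'rV[R]_m) *m (Q d - Q s)| <= 2 * (e / 3) * d.
    rewrite mulmxBr (le_trans H)//; lra.
  have := le_trans (mx_norm_entry _ 0 j) H.
  rewrite -scalemxAl -rowE !mxE normrM gtr0_norm// mulrC ler_pM2r//.
have /cvg_ex[/= L QL] := cvgQ.
have [] // := @is_diff_eps _ _ _ F p (mulmxr L) _ _.
  exact: mulmxr_cont.
move=> e e0; have [|d d0 Fd] := FQ (e / 2); first by rewrite divr_gt0.
near=> h.
have hd : `|h| <= d by near: h; exact: (@nbhs0_le R 'rV[R]_m).
near (0 : R)^'+ => s.
have sd : 0 < s <= d.
  by apply/andP; split; near: s; [exact: nbhs_right_gt|exact: nbhs_right_le].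
have QsL : `|L - Q s| <= e / 2 / m.+1%:R.
  near: s; move/cvgrPdist_le : QL => /(_ (e / 2 / m.+1%:R)); apply.
  by rewrite !divr_gt0.
have -> : F (p + h) - F p - mulmxr L h =
    (F (p + h) - F p - h *m Q s) - h *m (L - Q s).
  by rewrite mulmxBr opprB addrA subrK.
rewrite (le_trans (ler_normB _ _))// [in leRHS](splitr e) mulrDl lerD//.
  exact: Fd.
rewrite (le_trans (mx_norm_mulmx _ _))// ler_wpM2r//.
rewrite -[leRHS](divfK (_ : m.+1%:R != 0)) ?pnatr_eq0// mulrC.
by apply: ler_pM => //; rewrite ler_nat.
Unshelve. all: end_near. Qed.

(** A form of Heine's theorem: local closeness at each point of
   the compact set S gives a neighbourhood of 0 that serves all of S. *)
Lemma uniform_near (S : set R) p (V : normedModType R) (D : R -> 'rV[R]_p -> V) :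
  compact S ->
  (forall t, S t -> forall e, 0 < e ->
    \forall s \near t & k \near (0 : 'rV[R]_p), S s -> `|D s k - D t 0| <= e) ->
  forall e, 0 < e ->
    \forall k \near (0 : 'rV[R]_p), forall s, S s -> `|D s k - D s 0| <= e.
Proof.
move=> cS cD e e0.
have covS := (near_covering_withinP S).2 ((compact_near_coveringP S).1 cS).
apply: (covS _ (nbhs (0 : 'rV[R]_p)) (fun k s => `|D s k - D s 0| <= e) _) => t St.
have e20 : 0 < e / 2 by rewrite divr_gt0.
have := cD t St _ e20; move=> [[A B] /= [At B0] AB].
exists (A, B) => //= -[s k] /= [As Bk] Ss.
have H1 := AB (s, k) (conj As Bk) Ss; rewrite /= in H1.
have H2 := AB (s, 0) (conj As (nbhs_singleton B0)) Ss; rewrite /= in H2.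
have := ler_normB (D s k - D t 0) (D s 0 - D t 0).
rewrite opprB addrA subrK => /le_trans; apply.
by rewrite [leRHS]splitr lerD.
Qed.

(** On the segment from 0 to k the function a |-> G s (a k) - a (k D s 0) has the
   derivative k (D s (a k) - D s 0), which is small uniformly in s. *)
Lemma uniform_linearization (S : set R) p m (G : R -> 'rV[R]_p -> 'rV[R]_m)
    (D : R -> 'rV[R]_p -> 'M[R]_(p, m)) (r : R) : compact S -> 0 < r ->
  (forall s k, S s -> `|k| < r -> is_diff k (G s) (mulmxr (D s k))) ->
  (forall t, S t -> forall e, 0 < e ->
    \forall s \near t & k \near (0 : 'rV[R]_p), S s -> `|D s k - D t 0| <= e) ->
  forall e, 0 < e -> exists2 d, 0 < d & forall s k, S s -> `|k| <= d ->
    `|G s k - G s 0 - k *m D s 0| <= e * `|k|.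
Proof.
move=> cS r0 dG cD e e0.
(* For the max norm |k A| <= p |A| |k|; p.+1 covers the case p = 0. *)
have e'0 : 0 < e / p.+1%:R by rewrite divr_gt0.
have /nbhs_norm0P[d1 /= d10 d1D] := uniform_near cS cD e'0.
exists (Num.min d1 r / 2); first by rewrite divr_gt0// lt_min d10.
move=> s k Ss kd.
have kr (a : R) : a \in `[0, 1] -> `|a *: k| < Num.min d1 r.
  rewrite in_itv/= => /andP[a0 a1]; rewrite normrZ ger0_norm//.
  rewrite (@le_lt_trans _ _ `|k|)// ?ler_piMl//.
  by rewrite (le_lt_trans kd)// ltr_pdivrMr// ltr_pMr ?ltr1n// lt_min d10.
pose w a := G s (a *: k) - a *: (k *m D s 0).
have dw (a : R) : a \in `[0, 1] -> is_derive a 1 w (k *m (D s (a *: k) - D s 0)).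
  move=> a01.
  move: (kr a a01); rewrite lt_min => /andP[_ /(dG s (a *: k) Ss) dGa].
  rewrite mulmxBr; apply: is_deriveB.
    have := is_diff_comp (is_diff_scalel a k) dGa.
    by move=> /is_derive1_diff; rewrite /= scale1r.
  have := is_derive1_diff (is_diff_scalel a (k *m D s 0)).
  by rewrite scale1r.
have cw : {within `[0, 1], continuous w}.
  by apply: derivable_within_continuous => a /dw[].
have oo_cc (a : R) : a \in `]0, 1[ -> a \in `[0, 1] by exact: subset_itv_oo_cc.
have -> : G s k - G s 0 - k *m D s 0 = w 1 - w 0.
  by rewrite /w !scale1r !scale0r subr0 addrAC.
pose dw' (a : R) := k *m (D s (a *: k) - D s 0).
have dw01 (a : R) : a \in `]0, 1[ -> is_derive a 1 w (dw' a) by move=> /oo_cc/dw.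
clearbody w.
pose H (a : R) := e * `|k| * a.
have cH : {within `[0, 1], continuous H}.
  by apply: continuous_subspaceT; exact: mulrl_continuous.
have dH (a : R) : a \in `]0, 1[ -> is_derive a 1 H (cst (e * `|k|) a).
  by move=> _; apply: is_derive_eq; rewrite -![_ *: _]/(_ * _) /cst; ring.
have := @mean_value_le R m 0 1 w dw' H (cst (e * `|k|)) ler01 cw cH dw01 dH.
have -> : H 1 - H 0 = e * `|k| by rewrite /H mulr1 mulr0 subr0.
apply => a /oo_cc a01.
rewrite /dw' /cst (le_trans (mx_norm_mulmx _ _))// ler_wpM2r//.
have := d1D (a *: k); rewrite /=; move: (kr a a01); rewrite lt_min => /andP[-> _].
move=> /(_ isT s Ss) Da; rewrite -[leRHS](divfK (_ : p.+1%:R != 0)) ?pnatr_eq0// mulrC.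
by apply: ler_pM => //; rewrite ler_nat.
Qed.

Lemma uniform_bound (S : set R) p m (D : R -> 'M[R]_(p, m)) : compact S ->
  {within S, continuous D} ->
  exists2 K, 0 < K & forall s (k : 'rV_p), S s -> `|k *m D s| <= K * `|k|.
Proof.
move=> cS cD.
have [M [Mr MP]] := compact_bounded (continuous_compact cD cS).
exists (p%:R * (`|M| + 1) + 1).
  by rewrite ltr_wpDl// mulr_ge0// addr_ge0.
move=> s k Ss; rewrite (le_trans (mx_norm_mulmx _ _))// ler_wpM2r//.
rewrite (@le_trans _ _ (p%:R * (`|M| + 1)))// ?lerDl// ler_wpM2l//.
apply: (MP (`|M| + 1)); last by exists s.
by rewrite (le_lt_trans (ler_norm _))// ltrDl.
Qed.

End smooth_dependence.

(** * Jacobians of functions of class C^1 on the strip *)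

Section C1_data.
Context {R : realType} {nx nt m : nat}.
Implicit Types L : {linear (R^o * 'rV[R]_nx * 'rV[R]_nt)%type -> 'rV[R]_m}.

(** Matrix of the partial differential in the state and the parameter, both put in
   a single row vector; time is frozen. *)
Definition state_mx (L : R^o * 'rV[R]_nx * 'rV[R]_nt -> 'rV[R]_m) :
    'M[R]_(nx + nt, m) :=
  \matrix_(i, j) L (0, lsubmx 'e_i, rsubmx 'e_i) 0 j.

Lemma mul_state_mx L (h : 'rV[R]_(nx + nt)) :
  h *m state_mx L = L (0, lsubmx h, rsubmx h).
Proof.
pose j (k : 'rV[R]_(nx + nt)) : R^o * 'rV[R]_nx * 'rV[R]_nt :=
  (0, lsubmx k, rsubmx k).
have jD : {morph j : k l / k + l}.
  by move=> k l; rewrite /j !linearD /=; congr (_, _, _); rewrite addr0.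
have jZ a k : j (a *: k) = a *: j k.
  by rewrite /j !linearZ /=; congr (_, _, _); rewrite scaler0.
have j0 : j 0 = 0 by rewrite /j !linear0.
rewrite -[RHS]/(L (j h)) [in RHS](row_sum_delta h) (big_morph j jD j0) linear_sum.
apply/rowP => l; rewrite mxE summxE; apply: eq_bigr => i _.
by rewrite jZ linearZ !mxE.
Qed.

Lemma linear_triple_bounded L :
  exists2 c : R, 0 <= c & forall h, `|L h| <= c * `|h|.
Proof.
exists (`|L (1, 0, 0)| + (nx + nt)%:R * `|state_mx L|).
  by rewrite addr_ge0// mulr_ge0.
move=> [[a v] k].
have E : (a, v, k) = a *: (1, 0, 0) + (0, v, k) :> R^o * 'rV[R]_nx * 'rV[R]_nt.
  by congr (_, _, _); rewrite /= ?scaler0 ?add0r// addr0 [RHS]mulr1.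
rewrite [in leLHS]E {E} linearD linearZ /=.
have -> : L (0, v, k) = row_mx v k *m state_mx L.
  by rewrite mul_state_mx row_mxKl row_mxKr.
rewrite (le_trans (ler_normD _ _))// mulrDl lerD//.
  rewrite normrZ mulrC ler_wpM2l//.
  by rewrite !prod_normE/= !le_max lexx.
rewrite (le_trans (mx_norm_mulmx _ _))// ler_wpM2l ?mulr_ge0//.
rewrite (le_trans (mx_norm_row_mx _ _))//.
by rewrite !prod_normE/= ge_max !le_max !lexx !orbT.
Qed.

Context (T : R) (Th : set 'rV[R]_nt) (F : R -> 'rV[R]_nx -> 'rV[R]_nt -> 'rV[R]_m).

Lemma C1_on_continuous : C1_on T Th F ->
  {within `[0, T] `*` setT `*` Th,
    continuous (fun z : R * 'rV[R]_nx * 'rV[R]_nt => F z.1.1 z.1.2 z.2)}.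
Proof.
move=> [dF [dFP _]]; apply/subspace_continuousP => z Az.
have [c c0 Lc] := linear_triple_bounded (dF z).
apply/cvgrPdist_le => e e0.
have /eqoP/(_ 1 ltr01) := dFP z Az.
have : \forall x \near within (`[0, T] `*` setT `*` Th) (nbhs z),
    `|x - z : R^o * 'rV[R]_nx * 'rV[R]_nt| <= e / (1 + c).
  apply: cvg_within; near=> x; rewrite distrC; near: x.
  apply: (@cvgr_dist_le _ (R^o * 'rV[R]_nx * 'rV[R]_nt)%type _ (nbhs z) _ id z) => //.
  by rewrite divr_gt0// ltr_pwDl.
apply: filterS2 => x xz Fx; rewrite /from_subspace distrC.
rewrite -(subrK (dF z (x - z)) (F x.1.1 x.1.2 x.2 - F z.1.1 z.1.2 z.2)).
rewrite (le_trans (ler_normD _ _))// (le_trans (lerD Fx (Lc _)))// -mulrDl.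
rewrite -[leRHS](divfK (_ : 1 + c != 0)) ?gt_eqF ?ltr_pwDl// mulrC.
by rewrite ler_wpM2r// addr_ge0.
Unshelve. all: end_near. Qed.

Lemma split_state_cvg (t : R) (q : 'rV[R]_(nx + nt)) :
  (sk.1, lsubmx sk.2, rsubmx sk.2) @[sk --> (t, q)] -->
    ((t, lsubmx q, rsubmx q) : R^o * 'rV[R]_nx * 'rV[R]_nt).
Proof.
have c1 : sk.1 @[sk --> (t, q)] --> (t : R^o) by exact: cvg_fst.
have c2 : lsubmx sk.2 @[sk --> (t, q)] --> lsubmx q.
  by apply: (cvg_comp _ _ cvg_snd); exact: continuous_lsubmx.
have c3 : rsubmx sk.2 @[sk --> (t, q)] --> rsubmx q.
  by apply: (cvg_comp _ _ cvg_snd); exact: continuous_rsubmx.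
exact: cvg_pair (cvg_pair c1 c2) c3.
Qed.

Lemma rsubmx_near (t : R) (q : 'rV[R]_(nx + nt)) : Th° (rsubmx q) ->
  \forall sk \near (t, q), Th (rsubmx sk.2).
Proof.
have c3 : rsubmx sk.2 @[sk --> (t, q)] --> rsubmx q.
  by apply: (cvg_comp _ _ cvg_snd); exact: continuous_rsubmx.
by move=> thq; exact: c3 _ thq.
Qed.

Lemma shift_cvg n (t : R) (q : 'rV[R]_n) :
  (t, q + h) @[h --> (0 : 'rV[R]_n)] --> (t, q).
Proof.
have c1 : t @[h --> (0 : 'rV[R]_n)] --> t.
  exact: (@cvg_cst _ t _ (nbhs (0 : 'rV[R]_n)) _).
have c2 : q + h @[h --> (0 : 'rV[R]_n)] --> q.
  rewrite -[X in _ --> (X : 'rV_n)]addr0.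
  by apply: (@cvgD _ 'rV[R]_n _ (nbhs (0 : 'rV[R]_n)) _ (cst q) id);
    [exact: cvg_cst|exact: cvg_id].
exact: cvg_pair c1 c2.
Qed.

(** For th in the interior of Th the relative differential is a genuine
   differential in the variables (state, parameter). In finite dimension the
   continuity of the differential at each fixed vector is continuity in norm. *)
Lemma C1_on_jacobian : C1_on T Th F ->
  exists M : R -> 'rV[R]_(nx + nt) -> 'M[R]_(nx + nt, m),
    (forall (s : R) q, s \in `[0, T] -> Th° (rsubmx q) ->
      is_diff q (fun q => F s (lsubmx q) (rsubmx q)) (mulmxr (M s q))) /\
    (forall (t : R) q, t \in `[0, T] -> Th° (rsubmx q) -> forall e, 0 < e ->
      \forall s \near t & k \near q, s \in `[0, T] -> `|M s k - M t q| <= e).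
Proof.
move=> [dF [dFP dFc]].
exists (fun s q => state_mx (dF (s, lsubmx q, rsubmx q))); split=> [s q sT thq|].
  apply: is_diff_eps; first exact: mulmxr_cont.
  move=> e e0.
  have sqA : (`[0, T] `*` setT `*` Th) (s : R^o, lsubmx q, rsubmx q).
    by split; [split|exact: interior_subset].
  have /eqoP/(_ e e0) := dFP _ sqA; rewrite nearE => /= dFe.
  have cq := @shift_cvg _ s q.
  have : \forall h \near (0 : 'rV[R]_(nx + nt)), Th (rsubmx (q + h)).
    exact: (cq _ (@rsubmx_near s q thq)).
  have : \forall h \near (0 : 'rV[R]_(nx + nt)),
      (`[0, T] `*` setT `*` Th) (s : R^o, lsubmx (q + h), rsubmx (q + h)) ->
      `|F s (lsubmx (q + h)) (rsubmx (q + h)) - F s (lsubmx q) (rsubmx q) -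
        dF (s : R^o, lsubmx q, rsubmx q) (0, lsubmx h, rsubmx h)| <=
      e * `|(0, lsubmx h, rsubmx h) : R^o * 'rV[R]_nx * 'rV[R]_nt|.
    have := cq _ (@split_state_cvg s q _ dFe);
    apply: (@filterS _ (nbhs (0 : 'rV[R]_(nx + nt)))) => h /= hA /hA.
    have -> // : (0, lsubmx h, rsubmx h) = (s : R^o, lsubmx (q + h), rsubmx (q + h))
        - (s, lsubmx q, rsubmx q) :> R^o * 'rV[R]_nx * 'rV[R]_nt.
    by congr (_, _, _); rewrite /= ?subrr// linearD /= addrAC subrr add0r.
  apply: (@filterS2 _ (nbhs (0 : 'rV[R]_(nx + nt)))) => h hA hTh; rewrite mul_state_mx.
  rewrite (le_trans (hA _))//.
  rewrite ler_wpM2l ?(ltW e0)// !prod_normE /= normr0 !ge_max normr_ge0.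
  by rewrite mx_norm_lsubmx mx_norm_rsubmx.
move=> t q tT thq e e0.
have tqA : (`[0, T] `*` setT `*` Th) (t : R^o, lsubmx q, rsubmx q).
  by split; [split|exact: interior_subset].
have thk := @rsubmx_near t q thq.
have ent i : \forall sk \near (t, q),
    (`[0, T] `*` setT `*` Th) (sk.1, lsubmx sk.2, rsubmx sk.2) ->
    `|dF (sk.1 : R^o, lsubmx sk.2, rsubmx sk.2) (0, lsubmx 'e_i, rsubmx 'e_i) -
      dF (t : R^o, lsubmx q, rsubmx q) (0, lsubmx 'e_i, rsubmx 'e_i)| <= e.
  have /subspace_continuousP/(_ _ tqA)/cvgrPdist_le/(_ e e0) :=
    dFc (0, lsubmx 'e_i, rsubmx 'e_i).
  rewrite nearE /= => H.
  have := @split_state_cvg t q _ H;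
  apply: (@filterS _ (nbhs (t, q))) => sk /= H0 /H0.
  by rewrite /from_subspace distrC.
have entall : \forall sk \near (t, q), forall i,
    (`[0, T] `*` setT `*` Th) (sk.1, lsubmx sk.2, rsubmx sk.2) ->
    `|dF (sk.1 : R^o, lsubmx sk.2, rsubmx sk.2) (0, lsubmx 'e_i, rsubmx 'e_i) -
      dF (t : R^o, lsubmx q, rsubmx q) (0, lsubmx 'e_i, rsubmx 'e_i)| <= e.
  exact: (@filter_forall _ _ _ (nbhs (t, q))).
suff : \forall sk \near (t, q), sk.1 \in `[0, T] ->
    `|state_mx (dF (sk.1, lsubmx sk.2, rsubmx sk.2)) -
      state_mx (dF (t, lsubmx q, rsubmx q))| <= e by [].
move: thk entall; apply: (@filterS2 _ (nbhs (t, q))) => -[s k] /= kTh kM sT.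
apply: mx_norm_le => [|i l]; first exact: ltW.
rewrite !mxE; move: (kM i (conj (conj sT I) kTh)).
by apply: le_trans; rewrite (le_trans _ (mx_norm_entry _ 0 l))// !mxE.
Qed.

End C1_data.

(** * Fixed points of the Picard operator and solutions of the equation *)

Section picard_ode.
Context {R : realType} {nx nt : nat}.
Context (T : R) (Th : set 'rV[R]_nt) (f : R -> 'rV[R]_nx -> 'rV[R]_nt -> 'rV[R]_nx).
Context (T_gt0 : 0 < T).
Context (fc : {within `[0, T] `*` setT `*` Th,
    continuous (fun z : R * 'rV[R]_nx * 'rV[R]_nt => f z.1.1 z.1.2 z.2)}).

Lemma continuous_within_interior (V : topologicalType) (w : R -> V) (t : R) :
  {within `[0, T], continuous w} -> t \in `]0, T[ -> {for t, continuous w}.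
Proof.
move=> cw tT; have tT' : `[0, T]%classic° t.
  by rewrite interior_itv_bnd /= ?in_itv //=.
move: cw => /subspace_continuousP/(_ t (interior_subset tT')).
move=> cw B /cw; rewrite /within/= => H.
suff : \forall s \near t, B (w s) by [].
near=> s; have : `[0, T]%classic s by near: s.
by near: s.
Unshelve. all: end_near. Qed.

Lemma rhs_continuous (v : R -> 'rV[R]_nx) th : Th th ->
  {within `[0, T], continuous v} ->
  {within `[0, T], continuous (fun s => f s (v s) th)}.
Proof.
move=> thTh cv; apply/subspace_continuousP => s sT.
move/subspace_continuousP : fc => /(_ (s, v s, th)) /= cf.
apply: cvg_trans (cf _); last by [].
move=> B /= [[W V] [[[W1 W2] [W1s W2s] sW]] Vs sB].
have /subspace_continuousP/(_ s sT) cu := cv.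
move: (cu _ W2s); rewrite /= /within/= => H.
suff : \forall r \near s, `[0, T]%classic r -> B (f r (v r) th) by [].
near=> r => rT; apply: (sB (r, v r, th)) => //.
split; last exact: nbhs_singleton Vs.
apply: sW; split; first by near: r.
by move: rT; near: r.
Unshelve. all: end_near. Qed.

(** A derivative that extends continuously to the closed interval is also the
   one-sided derivative at its ends: by the mean value inequality, on a short
   interval around t the function s |-> w s - s (h t) is e-Lipschitz. *)
Lemma mean_value_quotient_cvg n (w h : R -> 'rV[R]_n) :
  {within `[0, T], continuous w} -> {within `[0, T], continuous h} ->
  (forall t, t \in `]0, T[ -> is_derive t 1 w (h t)) ->
  forall t, t \in `[0, T] ->
    (s - t)^-1 *: (w s - w t) @[s --> within `[0, T] t^'] --> h t.
Proof.
move=> cw ch dw t tT; apply/cvgrPdist_le => e e0.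
move: ch => /subspace_continuousP/(_ t tT)/cvgrPdist_le/(_ e e0).
rewrite !near_withinE => /nbhs_ballP[d /= d0 hd].
have key a b : 0 <= a -> b <= T -> a <= b -> (forall c, a < c < b -> `|t - c| < d) ->
    `|(w b - b *: h t) - (w a - a *: h t)| <= e * b - e * a.
  move=> a0 bT ab near_t.
  have sub : `[a, b] `<=` `[0, T] by apply: subset_itv; rewrite bnd_simp.
  pose v s := w s - s *: h t; pose G (s : R) := e * s.
  have cv : {within `[a, b], continuous v}.
    move=> s; apply: (@continuousB _ _ (subspace `[a, b])).
      exact: (continuous_subspaceW sub cw).
    by apply: continuous_subspaceT => r; exact: scalel_continuous.
  have cG : {within `[a, b], continuous G}.
    by apply: continuous_subspaceT; exact: mulrl_continuous.
  have dv s : s \in `]a, b[ -> is_derive s 1 v (h s - h t).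
    rewrite in_itv/= => /andP[as_ sb]; apply: is_deriveB.
      by apply: dw; rewrite in_itv/= (le_lt_trans a0)//= (lt_le_trans sb).
    by have := is_derive1_diff (is_diff_scalel s (h t)); rewrite scale1r.
  have dG (s : R) : s \in `]a, b[ -> is_derive s 1 G (cst e s).
    by move=> _; apply: is_derive_eq; rewrite -![_ *: _]/(_ * _) /cst; ring.
  have := @mean_value_le R n a b v _ G (cst e) ab cv cG dv dG.
  apply => s; rewrite in_itv/= => sab; rewrite /cst distrC.
  apply: hd; first exact: near_t.
  move: sab => /andP[as_ sb].
  by rewrite /= in_itv/= (le_trans a0 (ltW as_)) (le_trans (ltW sb)).
near=> s => st sT.
have std : `|t - s| < d by near: s; exact: nbhsx_ballx.
have kst : `|(w s - s *: h t) - (w t - t *: h t)| <= e * `|s - t|.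
  move: tT sT; rewrite !in_itv/= => /andP[t0 tT] /andP[s0 sT].
  have [lts|lst|E] := ltgtP s t; last by rewrite E eqxx in st.
    rewrite distrC ltr0_norm ?subr_lt0// [- (s - t)]opprB mulrBr.
    apply: (key s t s0 tT (ltW lts)) => c /andP[sc ct].
    rewrite gtr0_norm ?subr_gt0// (le_lt_trans _ std)//.
    by rewrite ger0_norm ?subr_ge0 ?lerD2l ?lerN2 ?ltW.
  rewrite gtr0_norm ?subr_gt0// mulrBr.
  apply: (key t s t0 sT (ltW lst)) => c /andP[tc cs].
  rewrite distrC gtr0_norm ?subr_gt0// (le_lt_trans _ std)//.
  by rewrite distrC ger0_norm ?subr_ge0 ?lerD2r ?ltW.
have st0 : s - t != 0 by rewrite subr_eq0.
rewrite -[X in `|X - _|](scalerK st0) -scalerBr normrZ normfV.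
rewrite ler_pdivrMl ?normr_gt0// mulrC -normrN opprB.
have -> // : w s - w t - (s - t) *: h t = w s - s *: h t - (w t - t *: h t).
by rewrite scalerBl !opprB addrACA [- w t - _]addrC addrACA.
Unshelve. all: end_near. Qed.

Lemma is_derive_picard_fun x th (v : R -> 'rV[R]_nx) t : Th th ->
  {within `[0, T], continuous v} -> t \in `]0, T[ ->
  is_derive t 1 (picard_fun f x th v) (f t (v t) th).
Proof.
move=> thTh cv tT; apply: is_derive_row => j.
have ch : {within `[0, T], continuous (fun s => f s (v s) th 0 j)}.
  exact: within_cont_entry (rhs_continuous thTh cv).
move: (tT); rewrite in_itv/= => /andP[t0 ltT].
have [] := continuous_FTC1_closed ltT _ t0 (continuous_within_interior ch tT).
  by apply: continuous_compact_integrable => //; exact: segment_compact.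
set I := (X in derivable X t 1) => dI IE.
have -> : (fun s => picard_fun f x th v s 0 j) = cst (x 0 j) + I.
  by apply/funext => s; rewrite /picard_fun !mxE.
rewrite -[X in is_derive _ _ _ X]add0r; apply: is_deriveD.
by apply: DeriveDef; [exact: dI|rewrite -derive1E; exact: IE].
Qed.

Lemma picard_fun_0 x th v : picard_fun f x th v 0 = x.
Proof.
by apply/rowP => j; rewrite !mxE set_itv1 Rintegral_set1 addr0.
Qed.

(** [picard] is by construction an element of C([0, T]), and it agrees with
   [picard_fun] on [0, T]. *)
Lemma picard_fun_continuous x th (u : contI T 'rV[R]_nx) : Th th ->
  {within `[0, T], continuous (picard_fun f x th u)}.
Proof.
move=> thTh.
apply: (subspace_eq_continuous _ (contIP (picard f x th u)).1) => s /set_mem sT.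
exact: picardE.
Qed.

Lemma is_derive_eq_oo n (w v : R -> 'rV[R]_n) t dw : {in `[0, T], w =1 v} ->
  t \in `]0, T[ -> is_derive t 1 w dw -> is_derive t 1 v dw.
Proof.
move=> wv tT; apply: near_eq_is_derive.
have : `]0, T[%classic° t by rewrite interior_itv_bnd.
apply: filterS => s /= sT; apply: wv; exact: subset_itv_oo_cc.
Qed.

Lemma picard_fixpoint_ode x th (u : contI T 'rV[R]_nx) : Th th ->
  {in `[0, T], u =1 picard_fun f x th u} -> ode_solution T f x th u.
Proof.
move=> thTh ux; have cu := (contIP u).1; split.
  by rewrite ux ?picard_fun_0// in_itv/= lexx ltW.
apply: (mean_value_quotient_cvg cu (rhs_continuous thTh cu)) => t tT.
apply: is_derive_eq_oo tT (is_derive_picard_fun x thTh cu tT) => s sT.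
by rewrite -ux.
Qed.

(** Both sides have the same initial value and the same derivative inside
   [0, T]. *)
Lemma picard_fixpoint x th (u : contI T 'rV[R]_nx) : Th th -> u 0 = x ->
  (forall t, t \in `]0, T[ -> is_derive t 1 u (f t (u t) th)) ->
  picard f x th u = u.
Proof.
move=> thTh u0 du; have cu := (contIP u).1.
apply: contI_eq => t tT; rewrite (picardE _ _ fc)//.
have cp := @picard_fun_continuous x th u thTh.
move: (tT); rewrite in_itv/= => /andP[t0 leT].
have sub : `[0, t] `<=` `[0, T] by apply: subset_itvl; rewrite bnd_simp.
pose w (s : R) : 'rV[R]_nx := u s - picard_fun f x th u s.
have cw : {within `[0, t], continuous w}.
  move=> s; apply: (@continuousB _ _ (subspace `[0, t])).
    exact: (continuous_subspaceW sub cu).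
  exact: (continuous_subspaceW sub cp).
have dw (s : R) : s \in `]0, t[ -> is_derive s 1 w (cst 0 s).
  rewrite in_itv/= => /andP[s0 st].
  have sT : s \in `]0, T[ by rewrite in_itv/= s0 (lt_le_trans st).
  have : is_derive s 1 w (f s (u s) th - f s (u s) th).
    by apply: is_deriveB; [exact: du|exact: is_derive_picard_fun].
  by rewrite subrr.
have cG : {within `[0, t], continuous (cst 0 : R -> R)}.
  by apply: continuous_subspaceT => s; exact: cvg_cst.
have dG (s : R) : s \in `]0, t[ -> is_derive s 1 (cst 0 : R -> R) (cst 0 s).
  by move=> _; exact: is_derive_cst.
have := @mean_value_le R nx 0 t w (cst 0) (cst 0) (cst 0) t0 cw cG dw dG.
rewrite (_ : cst 0 t - cst 0 0 = 0); last by rewrite /cst subr0.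
have w0 : w 0 = 0 by rewrite /w u0 picard_fun_0 subrr.
rewrite w0 subr0 => H; apply/esym/eqP; rewrite -subr_eq0 -normr_le0.
by apply: H => s _; rewrite /cst normr0.
Qed.

End picard_ode.

(** * Families of solutions of a nearly linear equation *)

Section variation.
Context {R : realType} {nx nt : nat}.

(** The model is w h = phi(., p + h) - phi(., p), where the row vector h perturbs
   first the initial value, then the parameter; A is the Jacobian of the vector
   field along the unperturbed solution. *)
Context (T K : R) (A : R -> 'M[R]_(nx + nt, nx)).
Context (w dw : 'rV[R]_(nx + nt) -> R -> 'rV[R]_nx).
Context (T_gt0 : 0 < T) (K_gt0 : 0 < K).
Context (AK : forall s (k : 'rV[R]_(nx + nt)), s \in `]0, T[ -> `|k *m A s| <= K * `|k|).
Context (d0 : R) (d0_gt0 : 0 < d0).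
Context (cw : forall h, `|h| <= d0 -> {within `[0, T], continuous (w h)}).
Context (dwP : forall h, `|h| <= d0 -> forall s, s \in `]0, T[ -> is_derive s 1 (w h) (dw h s)).
Context (w0 : forall h, `|h| <= d0 -> w h 0 = lsubmx h).
Context (dwA : forall e, 0 < e -> exists2 d, 0 < d & forall h s, `|h| <= d -> s \in `]0, T[ ->
  `|dw h s - row_mx (w h s) (rsubmx h) *m A s| <= e * Num.max `|w h s| `|h|).

Lemma variation_lipschitz : exists L, exists2 d, 0 < d &
  1 <= L /\ forall h s, `|h| <= d -> s \in `[0, T] -> `|w h s| <= L * `|h|.
Proof.
have [d d_gt0 wd] := dwA ltr01.
exists (1 + 2 * expR (2 * (K + 1) * T) * (1 + (K + 1) * T)); exists (Num.min d0 d).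
  by rewrite lt_min d0_gt0.
split; first by rewrite lerDl !mulr_ge0 ?expR_ge0 ?addr_ge0 ?mulr_ge0 ?ltW// addr_gt0.
move=> h s; rewrite le_min => /andP[hd0 hd] sT.
have K1 : 0 < K + 1 by rewrite addr_gt0.
have := gronwall (ltW T_gt0) K1 (_ : 0 <= (K + 1) * `|h|) (cw hd0) (dwP hd0) _ sT.
move=> H; rewrite (le_trans (H _ _))//.
- by rewrite mulr_ge0// ltW.
- move=> r rT; rewrite -(subrK (row_mx (w h r) (rsubmx h) *m A r) (dw h r)).
  rewrite (le_trans (ler_normD _ _))// (le_trans (lerD (wd _ _ hd rT) (AK _ rT)))//.
  set m := Num.max _ _.
  have mk : `|row_mx (w h r) (rsubmx h)| <= m.
    rewrite (le_trans (mx_norm_row_mx _ _))// ge_max !le_max lexx/=.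
    by rewrite mx_norm_rsubmx orbT.
  have mm : m <= `|w h r| + `|h| by rewrite ge_max lerDl lerDr !normr_ge0.
  rewrite -mulrDr mul1r (@le_trans _ _ ((K + 1) * m))//.
    by rewrite mulrDl mul1r addrC lerD2r ler_pM2l.
  by rewrite ler_pM2l.
have w0h : `|w h 0| <= `|h| by rewrite w0// mx_norm_lsubmx.
have C0 : 0 <= 2 * expR (2 * (K + 1) * T) by rewrite mulr_ge0// expR_ge0.
have : `|w h 0| + (K + 1) * `|h| * T <= (1 + (K + 1) * T) * `|h| by lra.
move=> /(ler_wpM2l C0) /le_trans; apply.
by rewrite [leRHS]mulrDl mul1r -[_ * `|h| in leRHS]mulrA lerDr.
Qed.

(** Let r be the difference of the two sides. As h is the sum of the (h_i / a) a e_i,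
   the initial values cancel, so r(0) = 0, and so do the parameter increments, so
   that r' = (r, 0) A up to an error e1 L (1 + n) |h| with n = nx + nt: one term
   comes from w h, and n terms |h_i / a| |a e_i| <= |h| come from the quotients.
   Gronwall's inequality concludes. *)
Lemma variation_quotient e : 0 < e -> exists2 d, 0 < d &
  forall h a s, `|h| <= d -> 0 < a <= d -> s \in `[0, T] ->
  `|w h s - h *m \matrix_(i < nx + nt) (a^-1 *: w (a *: 'e_i) s)| <= e * `|h|.
Proof.
move=> e0; have [L [dL dL0 [L1 wL]]] := variation_lipschitz.
have L0 : 0 < L by rewrite (lt_le_trans _ L1).
pose C := 2 * expR (2 * K * T).
have C0 : 0 < C by rewrite mulr_gt0// expR_gt0.
have CE : 2 * expR (2 * K * T) = C by [].
clearbody C; pose N : R := 1 + (nx + nt)%:R.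
have N0 : 0 < N by rewrite ltr_pwDl.
have NE : 1 + (nx + nt)%:R = N by [].
clearbody N.
(* C * T is the Gronwall constant, L the Lipschitz constant of w, and N counts
   the error terms. *)
pose e1 := e / (C * T * N * L).
have e10 : 0 < e1 by rewrite divr_gt0// !mulr_gt0.
have e1E : C * (e1 * L * N * T) = e.
  by rewrite /e1; field; rewrite !gt_eqF.
clearbody e1; have [d d_gt0 wd] := dwA e10.
exists (Num.min (Num.min d0 dL) d); first by rewrite !lt_min d0_gt0 dL0 d_gt0.
move=> h a s; rewrite !le_min => /andP[/andP[hd0 hdL] hd].
move=> /andP[a0 /andP[/andP[ad0 adL] ad]] sT.
have ae i : `|a *: 'e_i : 'rV[R]_(nx + nt)| = a.
  by rewrite normrZ mx_norm_delta mulr1 gtr0_norm.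
pose c i := h 0 i / a.
have hE : h = \sum_i c i *: (a *: 'e_i).
  rewrite {1}(row_sum_delta h); apply: eq_bigr => i _.
  by rewrite scalerA /c divfK// gt_eqF.
have -> : h *m \matrix_(i < nx + nt) (a^-1 *: w (a *: 'e_i) s) =
    \sum_i c i *: w (a *: 'e_i) s.
  rewrite mulmx_sum_row; apply: eq_bigr => i _.
  by rewrite rowK scalerA.
pose r t := w h t - \sum_i c i *: w (a *: 'e_i) t.
pose dr t := dw h t - \sum_i c i *: dw (a *: 'e_i) t.
have cr : {within `[0, T], continuous r}.
  move=> t; apply: (@continuousB _ _ (subspace `[0, T])); first exact: cw.
  have -> : (fun t => \sum_i c i *: w (a *: 'e_i) t) =
      \sum_i (fun t => c i *: w (a *: 'e_i) t).
    by apply/funext => q; rewrite fct_sumE.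
  elim/big_ind: _ => [|f g cf cg|i _].
  - exact: (@cvg_cst _ _ (subspace `[0, T])).
  - exact: (@continuousD _ _ (subspace `[0, T])).
  - apply: (@continuousZl_tmp _ _ (subspace `[0, T])).
    by apply: cw; rewrite ae.
have drP t : t \in `]0, T[ -> is_derive t 1 r (dr t).
  move=> tT; apply: is_deriveB; first exact: dwP.
  have -> : (fun t => \sum_i c i *: w (a *: 'e_i) t) =
      \sum_i (fun t => c i *: w (a *: 'e_i) t).
    by apply/funext => q; rewrite fct_sumE.
  apply: is_derive_sum => i; apply: is_deriveZ.
  by apply: dwP; rewrite ?ae.
have rM t : row_mx (r t) 0 = row_mx (w h t) (rsubmx h) -
    \sum_i c i *: row_mx (w (a *: 'e_i) t) (rsubmx (a *: 'e_i)).
  apply/esym; rewrite -[LHS]hsubmxK; congr row_mx; rewrite linearB linear_sum /=.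
    rewrite row_mxKl; congr (_ - _); apply: eq_bigr => i _.
    by rewrite linearZ /= row_mxKl.
  rewrite row_mxKr {1}hE linear_sum -sumrB big1// => i _.
  by rewrite linearZ [X in _ - X]linearZ /= row_mxKr subrr.
pose err k t := dw k t - row_mx (w k t) (rsubmx k) *m A t.
have drE t : dr t = row_mx (r t) 0 *m A t + (err h t - \sum_i c i *: err (a *: 'e_i) t).
  rewrite rM mulmxBl mulmx_suml /err.
  have -> : \sum_i c i *: (dw (a *: 'e_i) t -
        row_mx (w (a *: 'e_i) t) (rsubmx (a *: 'e_i)) *m A t) =
      \sum_i c i *: dw (a *: 'e_i) t -
      \sum_i c i *: row_mx (w (a *: 'e_i) t) (rsubmx (a *: 'e_i)) *m A t.
    by rewrite -sumrB; apply: eq_bigr => i _; rewrite scalerBr scalemxAl.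
  rewrite /dr; set Z := \sum_i _ *: dw _ _; set X := row_mx (w h t) _ *m A t.
  set Y := \sum_i _ *m A t; rewrite opprB [RHS]addrC [RHS]addrACA subrK.
  by rewrite [Y - Z - Y]addrAC subrr add0r.
have errh k t : `|k| <= Num.min dL d -> t \in `]0, T[ -> `|err k t| <= e1 * L * `|k|.
  rewrite le_min => /andP[kL kd] tT; rewrite (le_trans (wd _ _ kd tT))//.
  rewrite -mulrA ler_pM2l// ge_max wL//=; last exact: subset_itv_oo_cc.
  by rewrite ler_peMl.
have r0 : r 0 = 0.
  rewrite /r w0// {1}hE linear_sum -sumrB big1// => i _.
  by rewrite w0 ?ae// linearZ subrr.
have := gronwall (ltW T_gt0) K_gt0 (_ : 0 <= e1 * L * N * `|h|) cr drP _ sT.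
move=> H; rewrite (le_trans (H _ _))//.
- by rewrite mulr_ge0 ?normr_ge0 ?mulr_ge0 ?(ltW e10) ?(ltW L0) ?(ltW N0).
- move=> t tT; rewrite drE (le_trans (ler_normD _ _))// lerD//.
    rewrite (le_trans (AK _ tT))// ler_pM2l//.
    by rewrite (le_trans (mx_norm_row_mx _ _))// normr0 ge_max lexx normr_ge0.
  rewrite (le_trans (ler_normB _ _))//.
  rewrite (@le_trans _ _ (e1 * L * `|h| + \sum_(i < nx + nt) e1 * L * `|h|))//.
    rewrite lerD ?errh ?le_min ?hdL//.
    rewrite (le_trans (ler_norm_sum _ _ _))// ler_sum// => i _.
    rewrite normrZ (le_trans (ler_wpM2l (normr_ge0 _) (errh _ _ _ tT)))//.
      by rewrite ae le_min adL.
    rewrite ae /c normrM normfV (gtr0_norm a0).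
    have -> : `|h 0 i| / a * (e1 * L * a) = e1 * L * `|h 0 i|.
      by field; rewrite gt_eqF.
    by rewrite ler_pM2l ?mulr_gt0// mx_norm_entry.
  rewrite sumr_const card_ord -NE -[_ *+ (nx + nt)]mulr_natr.
  by rewrite le_eqVlt; apply/orP; left; apply/eqP; ring.
rewrite r0 normr0 add0r CE -e1E.
by rewrite le_eqVlt; apply/orP; left; apply/eqP; ring.
Qed.

End variation.

(** * Smooth dependence of the solution map *)

Section flow.
Context {R : realType} {nx nt : nat}.
Context (T : R) (X : set 'rV[R]_nx) (Th : set 'rV[R]_nt).
Context (f : R -> 'rV[R]_nx -> 'rV[R]_nt -> 'rV[R]_nx).
Context (phi : R -> 'rV[R]_nx -> 'rV[R]_nt -> 'rV[R]_nx).
Context (T_gt0 : 0 < T) (fC1 : C1_on T Th f) (phiP : solution_map T X Th f phi).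

Lemma ode_solution_is_derive x th u t : ode_solution T f x th u ->
  t \in `]0, T[ -> is_derive t 1 u (f t (u t) th).
Proof.
move=> [_ uP] tT.
have quot : (s - t)^-1 *: (u s - u t) @[s --> t^'] --> f t (u t) th.
  apply: cvg_trans (uP t _); last exact: subset_itv_oo_cc.
  have tT' : `]0, T[%classic° t by rewrite interior_itv_bnd.
  move=> B; rewrite /within /= => H.
  suff : \forall s \near t^', B ((s - t)^-1 *: (u s - u t)) by [].
  near=> s; have : `[0, T]%classic s.
    apply: subset_itv_oo_cc; near: s.
    exact: nbhs_dnbhs.
  by near: s.
have duq : h^-1 *: ((u \o shift t) (h *: 1) - u t) @[h --> 0^'] --> f t (u t) th.
  apply/cvgrPdist_le => e e0.
  move: quot => /cvgrPdist_le/(_ e e0); rewrite !near_withinE.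
  move=> /nbhs_ballP[d /= d0 dP]; apply/nbhs_ballP; exists d => //= h hd h0.
  have := dP (h + t); rewrite /= addrK [_%:A]mulr1; apply.
    by move: hd; rewrite /ball/= sub0r normrN opprD addrCA subrr addr0 normrN.
  by rewrite -subr_eq0 addrK.
by apply: DeriveDef; [exact: cvgP duq|exact: cvg_lim duq].
Unshelve. all: end_near. Qed.

Lemma flow_jointly_continuous x th t (e : R) : X° x -> Th° th -> t \in `[0, T] ->
  0 < e -> \forall s \near t & h \near (0 : 'rV[R]_(nx + nt)), s \in `[0, T] ->
  `|phi s (x + lsubmx h) (th + rsubmx h) - phi t x th| <= e.
Proof.
move=> xX thTh tT e0.
have [_ _ /subspace_continuousP phic] := phiP.
have txth : (`[0, T] `*` X `*` Th) (t, x, th).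
  by split; [split => //|]; exact: interior_subset.
have c1 : sk.1 @[sk --> (t, 0 : 'rV[R]_(nx + nt))] --> (t : R) by exact: cvg_fst.
have c2 : x + lsubmx sk.2 @[sk --> (t, 0 : 'rV[R]_(nx + nt))] --> x.
  rewrite -[X in _ --> (X : 'rV_nx)]addr0 -(@linear0 _ _ _ _ (@lsubmx R 1 nx nt)).
  apply: (@cvgD _ 'rV[R]_nx); first exact: cvg_cst.
  by apply: (cvg_comp _ _ cvg_snd); exact: continuous_lsubmx.
have c3 : th + rsubmx sk.2 @[sk --> (t, 0 : 'rV[R]_(nx + nt))] --> th.
  rewrite -[X in _ --> (X : 'rV_nt)]addr0 -(@linear0 _ _ _ _ (@rsubmx R 1 nx nt)).
  apply: (@cvgD _ 'rV[R]_nt); first exact: cvg_cst.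
  by apply: (cvg_comp _ _ cvg_snd); exact: continuous_rsubmx.
have /cvgrPdist_le/(_ e e0) := phic _ txth.
rewrite near_withinE => /(cvg_pair (cvg_pair c1 c2) c3) H.
suff : \forall sk \near (t, 0 : 'rV[R]_(nx + nt)), sk.1 \in `[0, T] ->
    `|phi sk.1 (x + lsubmx sk.2) (th + rsubmx sk.2) - phi t x th| <= e by [].
move: (c2 _ xX) (c3 _ thTh) H.
apply: (@filterS3 _ (nbhs (t, 0 : 'rV[R]_(nx + nt)))) => -[s h] /= hX hTh H sT.
by rewrite distrC; apply: H; split => //; split.
Qed.

Lemma flow_continuous x th : X x -> Th th ->
  {within `[0, T], continuous (phi ^~ x ^~ th)}.
Proof.
move=> xX thTh; apply/subspace_continuousP => t tT.
have [_ _ /subspace_continuousP phic] := phiP.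
have txth : (`[0, T] `*` X `*` Th) (t, x, th) by [].
apply/cvgrPdist_le => e e0.
have /cvgrPdist_le/(_ e e0) := phic _ txth.
have c1 : (s, x, th) @[s --> t] --> (t, x, th).
  have cx : x @[s --> t] --> x by exact: (@cvg_cst _ _ _ (nbhs t)).
  have cth : th @[s --> t] --> th by exact: (@cvg_cst _ _ _ (nbhs t)).
  exact: cvg_pair (cvg_pair cvg_id cx) cth.
rewrite !near_withinE => /c1; apply: (@filterS _ (nbhs t)) => s /= H sT.
by apply: H; split.
Qed.

Context (x : 'rV[R]_nx) (th : 'rV[R]_nt) (xX : X° x) (thTh : Th° th).

Let u s := phi s x th.
Let q0 s := row_mx (u s) th.
Let w (h : 'rV[R]_(nx + nt)) s := phi s (x + lsubmx h) (th + rsubmx h) - u s.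

Lemma parameters_near : \forall h \near (0 : 'rV[R]_(nx + nt)),
  X (x + lsubmx h) /\ Th° (th + rsubmx h).
Proof.
have c2 : x + lsubmx h @[h --> (0 : 'rV[R]_(nx + nt))] --> x.
  rewrite -[X in _ --> (X : 'rV_nx)]addr0 -(@linear0 _ _ _ _ (@lsubmx R 1 nx nt)).
  apply: (@cvgD _ 'rV[R]_nx _ (nbhs (0 : 'rV[R]_(nx + nt)))).
    exact: (@cvg_cst _ _ _ (nbhs (0 : 'rV[R]_(nx + nt)))).
  exact: continuous_lsubmx.
have c3 : th + rsubmx h @[h --> (0 : 'rV[R]_(nx + nt))] --> th.
  rewrite -[X in _ --> (X : 'rV_nt)]addr0 -(@linear0 _ _ _ _ (@rsubmx R 1 nx nt)).
  apply: (@cvgD _ 'rV[R]_nt _ (nbhs (0 : 'rV[R]_(nx + nt)))).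
    exact: (@cvg_cst _ _ _ (nbhs (0 : 'rV[R]_(nx + nt)))).
  exact: continuous_rsubmx.
move: (c2 _ xX) (c3 _ (nbhs_interior thTh)).
by apply: (@filterS2 _ (nbhs (0 : 'rV[R]_(nx + nt)))).
Qed.

Lemma uniform_flow_near e : 0 < e -> \forall h \near (0 : 'rV[R]_(nx + nt)),
  forall s, s \in `[0, T] -> `|w h s| <= e.
Proof.
have := @uniform_near R `[0, T] (nx + nt) _
  (fun s h => phi s (x + lsubmx h) (th + rsubmx h)) (@segment_compact _ _ _).
rewrite /= !linear0 !addr0; apply => t tT e1 e10.
exact: flow_jointly_continuous.
Qed.

(** By continuity of u, a property that holds near a point of the orbit can be
   read in the moving frame k |-> q0 s + k, where [uniform_linearization]
   applies. *)
Lemma orbit_near t (P : R -> 'rV[R]_(nx + nt) -> Prop) :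
  t \in `[0, T] ->
  (\forall s \near t & q \near q0 t, s \in `[0, T] -> P s q) ->
  \forall s \near t & k \near (0 : 'rV[R]_(nx + nt)), s \in `[0, T] -> P s (q0 s + k).
Proof.
move=> tT [[A B] /= [At Bq] AB].
have /nbhs_ballP[d /= d0 dB] := Bq.
have d20 : 0 < d / 2 by rewrite divr_gt0.
have /subspace_continuousP/(_ t tT)/cvgrPdist_lt/(_ _ d20) :=
  flow_continuous (interior_subset xX) (interior_subset thTh).
rewrite near_withinE => Cu.
have Bk : \forall k \near (0 : 'rV[R]_(nx + nt)), `|k| < d / 2 by exact: nbhs0_lt.
exists (A `&` [set s | s \in `[0, T] -> `|u t - u s| < d / 2], [set k | `|k| < d / 2]).
  by split => //; exact: filterI.
move=> [s k] [/= [As us] kd] sT; apply: (AB (s, _)) => //; split => //=.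
apply: dB; rewrite -ball_normE /= opprD addrA.
rewrite (le_lt_trans (ler_normB _ _))// [ltRHS]splitr ltrD//.
rewrite /q0 opp_row_mx add_row_mx subrr.
by rewrite (le_lt_trans (mx_norm_row_mx _ _))// normr0 gt_max us.
Qed.

Lemma orbit_linearization : exists A : R -> 'M[R]_(nx + nt, nx),
  {within `[0, T], continuous A} /\
  forall e, 0 < e -> exists2 d, 0 < d & forall s k, s \in `[0, T] -> `|k| <= d ->
    `|f s (u s + lsubmx k) (th + rsubmx k) - f s (u s) th - k *m A s| <= e * `|k|.
Proof.
have [M [dM cM]] := C1_on_jacobian fC1.
pose F s (q : 'rV[R]_(nx + nt)) := f s (lsubmx q) (rsubmx q).
have /nbhs_norm0P[r /= r0 rP] := parameters_near.
pose D s k := M s (q0 s + k).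
have cD t : `[0, T]%classic t -> forall e, 0 < e ->
    \forall s \near t & k \near (0 : 'rV[R]_(nx + nt)),
      `[0, T]%classic s -> `|D s k - D t 0| <= e.
  move=> tT e e0; rewrite /D addr0.
  have thq : Th° (rsubmx (q0 t)) by rewrite row_mxKr.
  apply: (@orbit_near t (fun s q => `|M s q - M t (q0 t)| <= e)) => //.
  exact: cM.
have dD s k : `[0, T]%classic s -> `|k| < r ->
    is_diff k (fun k => F s (q0 s + k)) (mulmxr (D s k)).
  move=> sT kr; apply: is_diff_shift; apply: dM => //.
  by rewrite linearD /= row_mxKr; have [] := rP k kr.
exists (D ^~ 0); split.
  apply/subspace_continuousP => t tT; apply/cvgrPdist_le => e e0.
  rewrite near_withinE; have [[A B] /= [At B0] AB] := cD t tT e e0.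
  apply: (@filterS _ (nbhs t) _ A) => // s As sT; rewrite distrC.
  by apply: (AB (s, 0)) => //; split => //=; exact: nbhs_singleton.
move=> e e0.
have [d d0 dP] := uniform_linearization (@segment_compact _ 0 T) r0 dD cD e0.
exists d => // s k sT kd; have := dP s k sT kd.
by rewrite /F addr0 !linearD /= !row_mxKl !row_mxKr.
Qed.

Let dw (h : 'rV[R]_(nx + nt)) s :=
  f s (phi s (x + lsubmx h) (th + rsubmx h)) (th + rsubmx h) - f s (u s) th.

(** The increments of the solution map satisfy the hypotheses of the previous
   part. Linearizing f requires w h to be small on all of [0, T]; this comes
   from the joint continuity of phi and the compactness of [0, T]. *)
Lemma flow_variation : exists A : R -> 'M[R]_(nx + nt, nx), exists K d0,
  [/\ 0 < K, 0 < d0,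
      forall s (k : 'rV[R]_(nx + nt)), s \in `]0, T[ -> `|k *m A s| <= K * `|k|,
      forall h, `|h| <= d0 -> [/\ X (x + lsubmx h), Th (th + rsubmx h),
        {within `[0, T], continuous (w h)},
        forall s, s \in `]0, T[ -> is_derive s 1 (w h) (dw h s) &
        w h 0 = lsubmx h] &
      forall e, 0 < e -> exists2 d, 0 < d & forall h s, `|h| <= d -> s \in `]0, T[ ->
        `|dw h s - row_mx (w h s) (rsubmx h) *m A s| <= e * Num.max `|w h s| `|h|].
Proof.
have [A [cA AP]] := orbit_linearization.
have [K K0 AK] := uniform_bound (@segment_compact _ 0 T) cA.
have /nbhs_norm0P[r /= r0 rP] := parameters_near.
have [phiode _ _] := phiP.
have [xX' thTh'] := (interior_subset xX, interior_subset thTh).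
exists A, K, (r / 2); split => //.
- by rewrite divr_gt0.
- by move=> s k sT; apply: AK; exact: subset_itv_oo_cc.
- move=> h hr; have [|xh /interior_subset thh] := rP h.
    by rewrite /= (le_lt_trans hr)// ltr_pdivrMr// ltr_pMr// ltr1n.
  split => //.
  + move=> s; apply: (@continuousB _ _ (subspace `[0, T])).
      exact: flow_continuous.
    exact: flow_continuous.
  + move=> s sT; apply: is_deriveB.
      by apply: (ode_solution_is_derive _ sT); exact: phiode.
    by apply: (ode_solution_is_derive _ sT); exact: phiode.
  + rewrite /w /u (phiode _ _ xh thh).1 (phiode _ _ xX' thTh').1.
    by rewrite addrAC subrr add0r.
move=> e e0; have [d d_gt0 dP] := AP e e0.
have /nbhs_norm0P[r1 /= r10 r1P] := uniform_flow_near d_gt0.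
exists (Num.min d (r1 / 2)); first by rewrite lt_min d_gt0 divr_gt0.
move=> h s; rewrite le_min => /andP[hd hr] /(@subset_itv_oo_cc _ _ _ _ _) sT.
have hr1 : `|h| < r1 by rewrite (le_lt_trans hr)// ltr_pdivrMr// ltr_pMr// ltr1n.
have kle : `|row_mx (w h s) (rsubmx h)| <= Num.max `|w h s| `|h|.
  rewrite (le_trans (mx_norm_row_mx _ _))// ge_max !le_max lexx/=.
  by rewrite mx_norm_rsubmx orbT.
have kd : `|row_mx (w h s) (rsubmx h)| <= d.
  by rewrite (le_trans kle)// ge_max hd andbT (r1P h).
have uw : u s + w h s = phi s (x + lsubmx h) (th + rsubmx h).
  by rewrite /w addrC subrK.
have := dP s _ sT kd; rewrite row_mxKl row_mxKr uw => H.
by rewrite (le_trans H)// ler_pM2l.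
Qed.

Lemma flow_lipschitz : exists L, exists2 d, 0 < d & 1 <= L /\
  forall h, `|h| <= d -> [/\ X (x + lsubmx h), Th (th + rsubmx h) &
    forall s, s \in `[0, T] -> `|w h s| <= L * `|h|].
Proof.
have [A [K [d0 [K0 d00 AK wP wA]]]] := flow_variation.
have [L [d d_gt0 [L1 wL]]] : exists L, exists2 d, 0 < d &
    1 <= L /\ forall h s, `|h| <= d -> s \in `[0, T] -> `|w h s| <= L * `|h|.
  by apply: (variation_lipschitz (dw := dw) T_gt0 K0 AK d00) => // h /wP[].
exists L, (Num.min d0 d); first by rewrite lt_min d00.
split => // h; rewrite le_min => /andP[/wP[Xh Thh _ _ _] hd].
by split => // s; exact: wL.
Qed.

Lemma flow_differentiable s : s \in `[0, T] ->
  differentiable (state_param_map phi s) (row_mx x th).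
Proof.
move=> sT; have [A [K [d0 [K0 d00 AK wP wA]]]] := flow_variation.
apply: (@differentiable_of_linear_approx _ _ _ _ _
  (fun a => \matrix_(i < nx + nt) (a^-1 *: w (a *: 'e_i) s))) => e e0.
have [d d_gt0 dP] : exists2 d, 0 < d & forall h a s, `|h| <= d -> 0 < a <= d ->
    s \in `[0, T] ->
    `|w h s - h *m \matrix_(i < nx + nt) (a^-1 *: w (a *: 'e_i) s)| <= e * `|h|.
  by apply: (variation_quotient (dw := dw) T_gt0 K0 AK d00) => // h /wP[].
exists d => // h a hd ad; have := dP h a s hd ad sT.
by rewrite {1}/w /state_param_map !linearD /= !row_mxKl !row_mxKr.
Qed.

End flow.

(** * Gradients as column vectors *)

Section gradients.
Context {R : realType}.

(** A linear form stored as its column of coefficients: composition with a linear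
   map becomes a matrix product, and the gradient is the transpose. *)
Definition lin_form n (c : 'cV[R]_n) (h : 'rV[R]_n) : R^o := (h *m c) 0 0.

Lemma lin_form_is_linear n (c : 'cV[R]_n) : linear (lin_form c).
Proof. by move=> a h k; rewrite /lin_form mulmxDl -scalemxAl !mxE. Qed.

HB.instance Definition _ n (c : 'cV[R]_n) :=
  GRing.isLinear.Build R 'rV[R]_n R^o *:%R (lin_form c) (lin_form_is_linear c).

Lemma lin_form_cont n (c : 'cV[R]_n) : continuous (lin_form c).
Proof.
apply: linear_bounded_cont => h.
exact: le_trans (mx_norm_entry _ 0 0) (mx_norm_mulmx h c).
Qed.

Lemma grad_is_diff n (F : 'rV[R]_n -> R) p (c : 'cV[R]_n) :
  is_diff p (F : _ -> R^o) (lin_form c) -> grad F p = c^T.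
Proof.
move=> [dF dE]; apply/rowP => j; rewrite !mxE (deriveE _ dF) dE.
by rewrite /lin_form -rowE mxE.
Qed.

Lemma jacobian_is_diff m n (F : 'rV[R]_m -> 'rV[R]_n) p (B : 'M[R]_(m, n)) :
  is_diff p F (mulmxr B) -> 'J F p = B.
Proof.
by move=> [_ dE]; apply/row_matrixP => i; rewrite !rowE mul_rV_lin1 dE.
Qed.

Lemma is_diff_jacobian m n (F : 'rV[R]_m -> 'rV[R]_n) p :
  differentiable F p -> is_diff p F (mulmxr ('J F p)).
Proof.
by move=> dF; apply: DiffDef => //; apply/funext => h; rewrite /= mul_rV_lin1.
Qed.

(** The remainder of the first-order expansion is the squared norm of h itself. *)
Lemma is_diff_sqnorm2 n (v : 'rV[R]_n) :
  is_diff v (sqnorm2 : _ -> R^o) (lin_form (2 *: v^T)).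
Proof.
apply: is_diff_eps; first exact: lin_form_cont.
move=> e e0; near=> h.
have -> : sqnorm2 (v + h) - sqnorm2 v - lin_form (2 *: v^T) h = sqnorm2 h.
  rewrite /sqnorm2 /lin_form mxE -!sumrB; apply: eq_bigr => j _.
  by rewrite !mxE; ring.
have hle : `|h| <= e / n.+1%:R.
  by near: h; apply: (@nbhs0_le R 'rV[R]_n); rewrite divr_gt0.
rewrite (le_trans (ler_norm_sum _ _ _))//.
rewrite (@le_trans _ _ (\sum_(j < n) e / n.+1%:R * `|h|))//.
  apply: ler_sum => j _; rewrite normrX expr2; apply: ler_pM => //.
    exact: le_trans (mx_norm_entry _ _ _) hle.
  exact: mx_norm_entry.
rewrite sumr_const card_ord -[_ *+ n]mulr_natr mulrAC ler_wpM2r//.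
by rewrite mulrAC -mulrA ler_piMr ?(ltW e0)// ler_pdivrMr// mul1r ler_nat.
Unshelve. all: end_near. Qed.

Lemma is_diff_comp_lin_form m n (F : 'rV[R]_m -> 'rV[R]_n) (H : 'rV[R]_n -> R) p
    (B : 'M[R]_(m, n)) (c : 'cV[R]_n) :
  is_diff p F (mulmxr B) -> is_diff (F p) (H : _ -> R^o) (lin_form c) ->
  is_diff p (H \o F : _ -> R^o) (lin_form (B *m c)).
Proof.
move=> dF dH; have := is_diff_comp dF dH.
by congr (is_diff_def _ _ _); apply/funext => h; rewrite /lin_form /= mulmxA.
Qed.

Lemma is_diff_row_mx m n1 n2 (F : 'rV[R]_m -> 'rV[R]_n1) (G : 'rV[R]_m -> 'rV[R]_n2) p B C :
  is_diff p F (mulmxr B) -> is_diff p G (mulmxr C) ->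
  is_diff p (fun q => row_mx (F q) (G q)) (mulmxr (row_mx B C)).
Proof.
move=> [dF FE] [dG GE]; apply: is_diff_eps; first exact: mulmxr_cont.
move=> e e0; have := diff_eps dF e0; have := diff_eps dG e0.
rewrite FE GE; apply: filterS2 => h /= Gh Fh.
rewrite mul_mx_row !opp_row_mx !add_row_mx.
by rewrite (le_trans (mx_norm_row_mx _ _))// ge_max Fh.
Qed.

Lemma is_diff_sum_lin_form (I : finType) n (F : I -> 'rV[R]_n -> R) p (c : I -> 'cV[R]_n) :
  (forall i, is_diff p (F i : _ -> R^o) (lin_form (c i))) ->
  is_diff p ((fun q => \sum_i F i q) : _ -> R^o) (lin_form (\sum_i c i)).
Proof.
move=> dF; have -> : (fun q => \sum_i F i q) = \sum_i (F i : _ -> R^o).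
  by apply/funext => q; rewrite fct_sumE.
apply: (big_ind2 (fun (F : _ -> R^o) c => is_diff p F (lin_form c))) => //.
- have := @is_diff_cst R 'rV[R]_n R^o 0 p; congr (is_diff_def _ _ _).
  by apply/funext => h; rewrite /lin_form mulmx0 mxE.
- move=> F1 c1 F2 c2 d1 d2; have := is_diffD d1 d2; congr (is_diff_def _ _ _).
  by apply/funext => h; rewrite /lin_form mulmxDr mxE.
Qed.

End gradients.

Section least_squares.
Context {R : realType} {nx nt ny N : nat}.
Context (g : R -> 'rV[R]_nx -> 'rV[R]_nt -> 'rV[R]_ny).
Context (y : 'I_N -> 'rV[R]_ny) (t : 'I_N -> R).

(** The states v i may depend on q. The theorem uses it twice: with v i the solution
   map, for the total derivative, and with v i constant, for the partial gradient.
   The minus sign comes from y i - g, and the 2 of the square cancels the one in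
   1 / (2 N). *)
Lemma is_diff_Lls (v : 'I_N -> 'rV[R]_(nx + nt) -> 'rV[R]_nx) p
    (B : 'I_N -> 'M[R]_(nx + nt, nx)) (M : 'I_N -> 'M[R]_(nx + nt, ny)) :
  (forall i, is_diff p (v i) (mulmxr (B i))) ->
  (forall i, is_diff (row_mx (v i p) (rsubmx p))
    (fun q => g (t i) (lsubmx q) (rsubmx q)) (mulmxr (M i))) ->
  is_diff p ((fun q => (2 * N%:R)^-1 *
      \sum_i sqnorm2 (y i - g (t i) (v i q) (rsubmx q))) : _ -> R^o)
    (lin_form (- (N%:R^-1 *: \sum_i row_mx (B i) (col_mx 0 1%:M) *m M i *m
      (y i - g (t i) (v i p) (rsubmx p))^T))).
Proof.
move=> dv dg.
pose G i q := y i - g (t i) (v i q) (rsubmx q).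
have dr : is_diff p (rsubmx : 'rV[R]_(nx + nt) -> 'rV_nt) (mulmxr (col_mx 0 1%:M)).
  have -> : (rsubmx : 'rV[R]_(nx + nt) -> 'rV_nt) = mulmxr (col_mx 0 1%:M).
    by apply/funext => q /=; rewrite -{2}[q]hsubmxK mul_row_col mulmx0 add0r mulmx1.
  apply: DiffDef; last by apply: diff_lin; exact: mulmxr_cont.
  by apply: linear_differentiable; exact: mulmxr_cont.
have dG i : is_diff p (G i) (mulmxr (- (row_mx (B i) (col_mx 0 1%:M) *m M i))).
  have := is_diffB (is_diff_cst (y i) p)
    (is_diff_comp (is_diff_row_mx (dv i) dr) (dg i)).
  have -> : cst (y i) - ((fun q => g (t i) (lsubmx q) (rsubmx q)) \o
      (fun q => row_mx (v i q) (rsubmx q))) = G i.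
    by apply/funext => q; rewrite /G /= !fctE /= row_mxKl row_mxKr.
  congr (is_diff_def _ _ _); apply/funext => h.
  by rewrite !fctE /= sub0r mulmxN mulmxA.
have := is_diff_sum_lin_form (fun i => is_diff_comp_lin_form (dG i) (is_diff_sqnorm2 (G i p))).
move=> /(is_diffZ (2 * N%:R)^-1).
congr (is_diff_def _ _ _); apply/funext => h; rewrite !fctE.
transitivity (lin_form ((2 * N%:R)^-1 *:
    \sum_i - (row_mx (B i) (col_mx 0 1%:M) *m M i) *m (2 *: (G i p)^T)) h).
  by rewrite /lin_form -scalemxAr [RHS]mxE.
congr (lin_form _ _); rewrite !scaler_sumr -sumrN; apply: eq_bigr => i _.
rewrite mulNmx -scalemxAr scalerN scalerA; congr (- (_ *: _)).
by rewrite invfM mulrAC mulVf ?mul1r// pnatr_eq0.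
Qed.

End least_squares.

(** * Stationary points of the constrained problem *)

Section stationary.
Context {R : realType} {nx nt ny N : nat}.
Context (T : R) (X : set 'rV[R]_nx) (Th : set 'rV[R]_nt).
Context (f : R -> 'rV[R]_nx -> 'rV[R]_nt -> 'rV[R]_nx).
Context (g : R -> 'rV[R]_nx -> 'rV[R]_nt -> 'rV[R]_ny).
Context (y : 'I_N -> 'rV[R]_ny) (t : 'I_N -> R).
Context (phi : R -> 'rV[R]_nx -> 'rV[R]_nt -> 'rV[R]_nx).
Context (T_gt0 : 0 < T) (fC1 : C1_on T Th f) (phiP : solution_map T X Th f phi).
Context (tT : forall i, t i \in `[0, T]).
Context (x : 'rV[R]_nx) (th : 'rV[R]_nt) (u : contI T 'rV[R]_nx).
Context (xX : X° x) (thTh : Th° th).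

Let v (p : 'rV[R]_(nx + nt)) s := phi s (lsubmx p) (rsubmx p).

Lemma flow_feasible x' th' : X x' -> Th th' ->
  picard f x' th' (to_contI T (phi ^~ x' ^~ th')) = to_contI T (phi ^~ x' ^~ th').
Proof.
move=> xX' thTh'; have [phiode _ _] := phiP.
have E := to_contIE (flow_continuous phiP xX' thTh').
apply: (picard_fixpoint (C1_on_continuous fC1) thTh').
  by rewrite E ?(phiode _ _ xX' thTh').1// in_itv/= lexx ltW.
move=> s sT; rewrite E; last exact: subset_itv_oo_cc.
apply: is_derive_eq_oo sT (ode_solution_is_derive (phiode _ _ xX' thTh') sT).
by move=> r rT /=; rewrite E.
Qed.

Lemma stationary_flow : stationary_point X Th f g y t x th u ->
  {in `[0, T], u =1 phi ^~ x ^~ th}.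
Proof.
move=> [Xx Thth ux _]; have [_ uniq _] := phiP.
apply: uniq => //.
exact: (picard_fixpoint_ode T_gt0 (C1_on_continuous fC1) Thth ux).
Qed.

(** The triples z h are feasible and depend on h in a Lipschitz way at 0, so a remainder
   o(|z h - z 0|) of the Lagrangian is a remainder o(|h|) of the objective. *)
Lemma reduced_objective_stationary : stationary_point X Th f g y t x th u ->
  is_diff (row_mx x th) ((fun p => Lls g y t (lsubmx p) (rsubmx p) (v p)) : _ -> R^o)
    (lin_form 0).
Proof.
move=> stat; have uphi := stationary_flow stat.
have [Xx Thth ux [l [_ dl dl0]]] := stat.
have [L [d d0 [L1 LP]]] := flow_lipschitz T_gt0 fC1 phiP xX thTh.
have L0 : 0 < L by rewrite (lt_le_trans ltr01).
pose z h : 'rV[R]_nx * 'rV[R]_nt * contI T 'rV[R]_nx :=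
  (x + lsubmx h, th + rsubmx h,
   to_contI T (phi ^~ (x + lsubmx h) ^~ (th + rsubmx h))).
have lagz h : X (x + lsubmx h) -> Th (th + rsubmx h) ->
    lagrangian f g y t l (z h) =
    Lls g y t (x + lsubmx h) (th + rsubmx h) (v (row_mx x th + h)).
  move=> Xh Thh; rewrite /lagrangian /= flow_feasible// subrr linear0 addr0.
  rewrite /Lls; congr (_ * _); apply: eq_bigr => i _.
  rewrite (to_contIE (flow_continuous phiP Xh Thh))//.
  by rewrite /v !linearD /= row_mxKl row_mxKr.
have zlip h : `|h| <= d -> `|z h - (x, th, u)| <= L * `|h|.
  move=> hd; have [Xh Thh wh] := LP h hd.
  have hL : `|h| <= L * `|h| by rewrite ler_peMl.
  rewrite !prod_normE /= !ge_max -!andbA; apply/and3P; split.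
  - by rewrite addrAC subrr add0r (le_trans (mx_norm_lsubmx _)).
  - by rewrite addrAC subrr add0r (le_trans (mx_norm_rsubmx _)).
  apply: contI_norm_le => [|s sT]; first by rewrite mulr_ge0// ltW.
  rewrite -[_ s]/(to_contI T _ s - u s) uphi//.
  by rewrite (to_contIE (flow_continuous phiP Xh Thh))//; exact: wh.
apply: is_diff_eps; first exact: lin_form_cont.
move=> e e0; have e1 : 0 < e / L by rewrite divr_gt0.
have z0 : z 0 = (x, th, u).
  rewrite /z !linear0 !addr0; congr (_, _, _); apply: contI_eq => s sT.
  by rewrite uphi// (to_contIE (flow_continuous phiP Xx Thth)).
have := diff_eps dl e1; rewrite dl0 => /nbhs_norm0P[r /= r0 rP].
near=> h.
have hd : `|h| <= d by near: h; apply: (@nbhs0_le R 'rV[R]_(nx + nt)).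
have hr : `|h| < r / L.
  by near: h; apply: (@nbhs0_lt R 'rV[R]_(nx + nt)); rewrite divr_gt0.
have [Xh Thh _] := LP h hd.
have kr : `|z h - (x, th, u)| < r.
  by rewrite (le_lt_trans (zlip h hd))// mulrC -ltr_pdivlMr.
have := rP _ kr; rewrite [(x, th, u) + _]addrC subrK lagz//.
have lag0 : lagrangian f g y t l (x, th, u) = Lls g y t x th (v (row_mx x th)).
  by rewrite -z0 lagz ?linear0 ?addr0.
rewrite lag0 -[0 (_ : _ * _ * _)]/(0 : R) /lin_form mulmx0 mxE !subr0.
rewrite !linearD /= !row_mxKl !row_mxKr => /le_trans; apply.
rewrite (le_trans (ler_wpM2l (ltW e1) (zlip h hd)))// mulrA divfK//.
by rewrite gt_eqF.
Unshelve. all: end_near. Qed.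

End stationary.

Lemma is_diff_state_arg (R : realType) nx nt ny
    (g : 'rV[R]_nx -> 'rV[R]_nt -> 'rV[R]_ny) (v : 'rV[R]_nx) th
    (M : 'M[R]_(nx + nt, ny)) :
  is_diff (row_mx v th) (fun q => g (lsubmx q) (rsubmx q)) (mulmxr M) ->
  is_diff v (fun w => g w th) (mulmxr (usubmx M)).
Proof.
move=> dg.
have did : is_diff v id (mulmxr 1%:M : 'rV[R]_nx -> 'rV_nx).
  have := is_diff_id v; congr (is_diff_def _ _ _).
  by apply/funext => h; rewrite /= mulmx1.
have dc : is_diff v (cst th) (mulmxr 0 : 'rV[R]_nx -> 'rV_nt).
  have := is_diff_cst th v; congr (is_diff_def _ _ _).
  by apply/funext => h; rewrite /= mulmx0.
have := is_diff_comp (is_diff_row_mx did dc) dg.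
rewrite (_ : _ \o _ = (fun w => g w th)); last first.
  by apply/funext => w; rewrite /= row_mxKl row_mxKr.
congr (is_diff_def _ _ _); apply/funext => h /=.
by rewrite mul_mx_row mulmx1 mulmx0 -{1}[M]vsubmxK mul_row_col mul0mx addr0.
Qed.

(** The total derivative of the reduced objective vanishes; its Jacobian factor
   row_mx J E splits as row_mx 0 E + row_mx J 0, the first part giving the partial
   gradient and the second one the sum over the measurement times. *)
Theorem proposition3 (R : realType) (nx nt ny N : nat) (T : R)
    (X : set 'rV[R]_nx) (Th : set 'rV[R]_nt)
    (f : R -> 'rV[R]_nx -> 'rV[R]_nt -> 'rV[R]_nx)
    (g : R -> 'rV[R]_nx -> 'rV[R]_nt -> 'rV[R]_ny)
    (y : 'I_N -> 'rV[R]_ny) (t : 'I_N -> R)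
    (phi : R -> 'rV[R]_nx -> 'rV[R]_nt -> 'rV[R]_nx)
    (x : 'rV[R]_nx) (th : 'rV[R]_nt) (u : contI T 'rV[R]_nx)
    (T_gt0 : 0 < T) (N_gt0 : (0 < N)%N)
    (cX : compact X) (vX : convex_set X)
    (cTh : compact Th) (vTh : convex_set Th)
    (fC1 : C1_on T Th f) (gC1 : C1_on T Th g)
    (tT : forall i, t i \in `[0, T])
    (phiP : solution_map T X Th f phi)
    (xX : X° x) (thTh : Th° th)
    (stat : stationary_point X Th f g y t x th u) :
  (forall i, differentiable (state_param_map phi (t i)) (row_mx x th)) /\
  grad_xth_Lls g y t x th u +
    \sum_i grad_ui_Lls g y t th u i *m jac_xth phi (t i) x th = 0.
Proof.
have dphi i := flow_differentiable T_gt0 fC1 phiP xX thTh (tT i).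
split; first exact: dphi.
have uphi := stationary_flow T_gt0 fC1 phiP stat.
have [M [dM _]] := C1_on_jacobian gC1.
pose p := row_mx x th.
pose G i := M (t i) (row_mx (u (t i)) th).
have dg i : is_diff (row_mx (u (t i)) th)
    (fun q => g (t i) (lsubmx q) (rsubmx q)) (mulmxr (G i)).
  by apply: dM => //; rewrite row_mxKr.
pose J i := 'J (state_param_map phi (t i)) p.
pose r i := (y i - g (t i) (u (t i)) th)^T.
pose E : 'M[R]_(nx + nt, nt) := col_mx 0 1%:M.
have pu i : state_param_map phi (t i) p = u (t i).
  by rewrite /state_param_map /p row_mxKl row_mxKr uphi.
have total : \sum_i row_mx (J i) E *m G i *m r i = 0.
  have := @is_diff_Lls R nx nt ny N g y t (fun i => state_param_map phi (t i)) p
    _ G (fun i => is_diff_jacobian (dphi i)).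
  have dgp i : is_diff (row_mx (state_param_map phi (t i) p) (rsubmx p))
      (fun q => g (t i) (lsubmx q) (rsubmx q)) (mulmxr (G i)).
    by rewrite pu /p row_mxKr.
  move=> /(_ dgp) /grad_is_diff H.
  have H0 := grad_is_diff (reduced_objective_stationary T_gt0 fC1 phiP tT xX thTh stat).
  have /trmx_inj/esym/eqP := etrans (esym H0) H.
  rewrite oppr_eq0 scaler_eq0 invr_eq0 pnatr_eq0 -leqn0 leqNgt N_gt0 => /eqP S0.
  by rewrite -[RHS]S0; apply: eq_bigr => i _; rewrite pu /p row_mxKr.
have partial : grad_xth_Lls g y t x th u =
    (- (N%:R^-1 *: \sum_i row_mx 0 E *m G i *m r i))^T.
  apply: grad_is_diff.
  have dcst i : is_diff p (cst (u (t i))) (mulmxr 0 : 'rV[R]_(nx + nt) -> 'rV_nx).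
    have := is_diff_cst (u (t i)) p; congr (is_diff_def _ _ _).
    by apply/funext => h; rewrite /= mulmx0.
  have := @is_diff_Lls _ _ _ _ _ g y t _ p _ G dcst.
  by rewrite /= row_mxKr; apply.
have state i : grad_ui_Lls g y t th u i *m jac_xth phi (t i) x th =
    (- (N%:R^-1 *: (row_mx (J i) 0 *m G i *m r i)))^T.
  rewrite /grad_ui_Lls /jac_u (jacobian_is_diff (is_diff_state_arg (dg i))).
  rewrite /jac_xth -/p -/(J i) -[in RHS](vsubmxK (G i)) mul_row_col mul0mx addr0.
  by rewrite [(- _)^T]linearN /= [(_ *: _)^T]linearZ /= !trmx_mul trmxK mulNmx -scalemxAl mulmxA.
rewrite partial (eq_bigr _ (fun i _ => state i)).
rewrite -linear_sum /= -linearD /= sumrN -opprD -scaler_sumr -scalerDr -big_split /=.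
rewrite (eq_bigr (fun i => row_mx (J i) E *m G i *m r i)) => [|i _]; last first.
  by rewrite -!mulmxDl add_row_mx add0r addr0.
by rewrite total scaler0 oppr0 trmx0.
Qed.
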